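(* Let $2\leq s<\infty$ be an integer, let $\{3,3,5\}$ denote the 600-cell, and let $\rho_0,\dots,\rho_4$ be the distinguished generators of $G(2^{\{3,3,5\},\mathcal{G}(s)})$. Put $\tilde{\rho}_0:=\rho_0\rho_1\rho_0$ and $H:=H(2^{\{3,3,5\},\mathcal{G}(s)})=\langle\tilde{\rho}_0,\rho_1,\rho_2,\rho_3,\rho_4\rangle$. Then the incidence system $\mathcal{H}(2^{\{3,3,5\},\mathcal{G}(s)})=\Gamma(H;(H_i)_{i\in\{0,\dots,4\}})$ is a regular hypertope and its automorphism group $H$, of order $7200\cdot(2s)^{60}$, is defined on the generators $\tilde{\rho}_0,\rho_1,\rho_2,\rho_3,\rho_4$ by the Coxeter relations $$\tilde{\rho}_0^2=\rho_1^2=\rho_2^2=\rho_3^2=\rho_4^2=(\tilde{\rho}_0\rho_2)^3=(\rho_1\rho_2)^3=(\rho_2\rho_3)^3=(\rho_3\rho_4)^5=id,$$ with all other pairs of distinct generators commuting, and the extra relations $$(\tilde{\beta}^{-i}\beta^i)^2=id\ \text{ for } i\in\{4,6,7,9,10,12\},\quad\text{and}\quad(\tilde{\beta}^{15}\beta^{15})^s=id,$$ where $\beta:=\rho_1\rho_2\rho_3\rho_4$ and $\tilde{\beta}:=\tilde{\rho}_0\rho_2\rho_3\rho_4$.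
   Context: C-groups and polytopes: a C-group of rank $m$ is a group $G$ with generating involutions $\rho_0,\dots,\rho_{m-1}$ satisfying $\langle\rho_i\mid i\in I\rangle\cap\langle\rho_j\mid j\in J\rangle=\langle\rho_k\mid k\in I\cap J\rangle$ for all $I,J\subseteq\{0,\dots,m-1\}$; it is a string C-group if $(\rho_i\rho_j)^2=id$ whenever $|i-j|\geq 2$. Abstract regular polytopes $\mathcal{P}$ of rank $m$ are in one-to-one correspondence with string C-groups $G(\mathcal{P})$ of rank $m$: the $i$-faces are the right cosets of $\langle\rho_j\mid j\neq i\rangle$, and vertices are the $0$-faces. Construction of $2^{\mathcal{P},\mathcal{G}(s)}$: let $\mathcal{P}$ be a centrally symmetric regular $n$-polytope with group $G(\mathcal{P})=\langle\tau_0,\dots,\tau_{n-1}\rangle$, i.e. $G(\mathcal{P})$ has a proper central involution $\alpha$ fixing no vertex. Let $F_0$ be the base vertex, stabilized by $\langle\tau_1,\dots,\tau_{n-1}\rangle$. Let $W$ be the Coxeter group generated by involutions $\sigma_F$, one for each vertex $F$ of $\mathcal{P}$, with defining relations $\sigma_F^2=id$, $(\sigma_F\sigma_{F\alpha})^s=id$, and $(\sigma_F\sigma_{F'})^2=id$ for $F'\notin\{F,F\alpha\}$. The group $G(\mathcal{P})$ acts on $W$ by $\tau^{-1}\sigma_F\tau=\sigma_{F\tau}$. Then $2^{\mathcal{P},\mathcal{G}(s)}$ is the regular $(n+1)$-polytope with group $G(2^{\mathcal{P},\mathcal{G}(s)}):=W\rtimes G(\mathcal{P})=\langle\rho_0,\dots,\rho_n\rangle$,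 where $\rho_0:=\sigma_{F_0}$ and $\rho_i:=\tau_{i-1}$ for $1\leq i\leq n$. For the 600-cell, $G(\mathcal{P})$ is the Coxeter group $[3,3,5]$ of order $14400$, there are $120$ vertices, and $\alpha=(\tau_0\tau_1\tau_2\tau_3)^{15}$. Hypertopes and halving: for a group $H$ with subgroups $(H_i)_{i\in I}$, $\Gamma(H;(H_i)_{i\in I})$ is the incidence system whose elements of type $i$ are the right cosets of $H_i$, two elements being incident iff the cosets intersect. A flag is a set of pairwise incident elements and a chamber is a flag containing an element of every type. A regular hypertope is an incidence system in which every flag lies in a chamber (a geometry) and which is thin (every flag missing exactly one type lies in exactly two chambers), residually connected (every residue of rank at least $2$ has connected incidence graph) and flag-transitive (type-preserving automorphisms are transitive on flags of each given type). Its automorphism group here means the group of type-preserving automorphisms. For a regular $(n+1)$-polytope with group $\langle\rho_0,\dots,\rho_n\rangle$, the halving group is $\langle\tilde{\rho}_0,\rho_1,\dots,\rho_n\rangle$ with $\tilde{\rho}_0=\rho_0\rho_1\rho_0$; $H_i$ is the subgroup generated by all these generators except the $i$-th one ($\tilde{\rho}_0$ being number $0$). *)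

(* Defs.v *)
From HB Require Import structures.
From mathcomp Require Import all_boot generic_quotient.
From mathcomp Require Import boolp classical_sets functions cardinality.
From Stdlib Require Import Relation_Operators.

Set Implicit Arguments.
Unset Strict Implicit.
Unset Printing Implicit Defensive.

Local Open Scope classical_set_scope.
Local Open Scope quotient_scope.
Local Open Scope group_scope.

(* [(i, false)] stands for the generator [x_i], [(i, true)] for its inverse. *)
Definition word (I : Type) := seq (I * bool).

Definition wgen (I : Type) (i : I) : word I := [:: (i, false)].
Definition winv (I : Type) (w : word I) : word I :=
  rev [seq (a.1, ~~ a.2) | a <- w].
Definition wexp (I : Type) (w : word I) (n : nat) : word I :=
  flatten (nseq n w).

Definition weval (G : groupType) (I : Type) (x : I -> G) (w : word I) : G :=
  \prod_(a <- w) (if a.2 then (x a.1)^-1 else x a.1).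

(* Equality of words in the group with generators [I] and relators [R]. *)
Inductive wequiv (I : Type) (R : set (word I)) : word I -> word I -> Prop :=
| wequiv_refl w : wequiv R w w
| wequiv_sym u v : wequiv R u v -> wequiv R v u
| wequiv_trans u v w : wequiv R u v -> wequiv R v w -> wequiv R u w
| wequiv_cat u u' v v' :
    wequiv R u u' -> wequiv R v v' -> wequiv R (u ++ v) (u' ++ v')
| wequiv_free i b : wequiv R [:: (i, b); (i, ~~ b)] [::]
| wequiv_rel r : R r -> wequiv R r [::].

Section PresentedGroup.
Variables (I : choiceType) (R : set (word I)).

Definition wequivb : rel (word I) := fun u v => `[< wequiv R u v >].

Lemma wequivb_refl : reflexive wequivb.
Proof. by move=> w; apply/asboolP; apply: wequiv_refl. Qed.

Lemma wequivb_sym : symmetric wequivb.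
Proof.
by move=> u v; apply/asboolP/asboolP => h; apply: wequiv_sym.
Qed.

Lemma wequivb_trans : transitive wequivb.
Proof.
move=> v u w /asboolP uv /asboolP vw; apply/asboolP.
exact: wequiv_trans uv vw.
Qed.

Canonical wequiv_equiv := EquivRel wequivb wequivb_refl wequivb_sym wequivb_trans.

Definition pgroup : Type := {eq_quot wequiv_equiv}.
HB.instance Definition _ := Choice.on pgroup.
HB.instance Definition _ := EqQuotient.on pgroup.

Definition pg_class (w : word I) : pgroup := \pi_pgroup w.
Definition pgen (i : I) : pgroup := pg_class (wgen i).

Lemma pg_classP u v : pg_class u = pg_class v <-> wequiv R u v.
Proof.
by split=> [/eqmodP/asboolP //|uv]; apply/eqmodP/asboolP.
Qed.

Lemma pg_reprK q : pg_class (repr q) = q.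
Proof. exact: reprK. Qed.

Lemma wequiv_repr w : wequiv R (repr (pg_class w)) w.
Proof. by apply/pg_classP; rewrite pg_reprK. Qed.

Lemma winv_cons (a : I * bool) w : winv (a :: w) = winv w ++ [:: (a.1, ~~ a.2)].
Proof. by rewrite /winv /= rev_cons cats1. Qed.

Lemma winv_cat (u v : word I) : winv (u ++ v) = winv v ++ winv u.
Proof. by rewrite /winv map_cat rev_cat. Qed.

Lemma wequiv_catV w : wequiv R (w ++ winv w) [::].
Proof.
elim: w => [|[i b] w IH] /=; first exact: wequiv_refl.
rewrite winv_cons -cat_cons catA.
apply: (@wequiv_trans _ _ _ ([:: (i, b)] ++ [:: (i, ~~ b)])).
  apply: wequiv_cat; last exact: wequiv_refl.
  rewrite /= -cat1s -[X in wequiv _ _ X]cats0.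
  by apply: wequiv_cat => //; apply: wequiv_refl.
exact: wequiv_free.
Qed.

Lemma winvK : involutive (@winv I).
Proof.
move=> w; rewrite /winv map_rev revK -map_comp -[RHS]map_id.
by apply: eq_map => -[i b] /=; rewrite negbK.
Qed.

Lemma wequiv_winv u v : wequiv R u v -> wequiv R (winv u) (winv v).
Proof.
move=> uv.
apply: (@wequiv_trans _ _ _ (winv u ++ (v ++ winv v))).
  rewrite -[X in wequiv _ X _]cats0; apply: wequiv_cat; first exact: wequiv_refl.
  by apply: wequiv_sym; apply: wequiv_catV.
rewrite catA -[X in wequiv _ _ X]cat0s; apply: wequiv_cat; last exact: wequiv_refl.
apply: (@wequiv_trans _ _ _ (winv u ++ u)).
  by apply: wequiv_cat; [exact: wequiv_refl|exact: wequiv_sym].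
by rewrite -{2}(winvK u); apply: wequiv_catV.
Qed.

Definition pg_mul (p q : pgroup) : pgroup := pg_class (repr p ++ repr q).
Definition pg_inv (p : pgroup) : pgroup := pg_class (winv (repr p)).

Lemma pg_mul_class u v : pg_mul (pg_class u) (pg_class v) = pg_class (u ++ v).
Proof. by apply/pg_classP; apply: wequiv_cat; apply: wequiv_repr. Qed.

Lemma pg_inv_class u : pg_inv (pg_class u) = pg_class (winv u).
Proof. by apply/pg_classP; apply: wequiv_winv; apply: wequiv_repr. Qed.

Lemma pg_mulA : associative pg_mul.
Proof.
move=> p q r; rewrite -(pg_reprK p) -(pg_reprK q) -(pg_reprK r).
by rewrite !pg_mul_class catA.
Qed.

Lemma pg_mul1 : left_id (pg_class [::]) pg_mul.
Proof. by move=> p; rewrite -(pg_reprK p) pg_mul_class. Qed.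

Lemma pg_mulr1 : right_id (pg_class [::]) pg_mul.
Proof. by move=> p; rewrite -(pg_reprK p) pg_mul_class cats0. Qed.

Lemma pg_mulV : left_inverse (pg_class [::]) pg_inv pg_mul.
Proof.
move=> p; rewrite -(pg_reprK p) pg_inv_class pg_mul_class.
by apply/pg_classP; rewrite -{2}(winvK (repr p)); apply: wequiv_catV.
Qed.

Lemma pg_mulrV : right_inverse (pg_class [::]) pg_inv pg_mul.
Proof.
move=> p; rewrite -(pg_reprK p) pg_inv_class pg_mul_class.
by apply/pg_classP; apply: wequiv_catV.
Qed.

HB.instance Definition _ :=
  isGroup.Build pgroup pg_mulA pg_mul1 pg_mulr1 pg_mulV pg_mulrV.

Lemma weval_pgen w : weval pgen w = pg_class w.
Proof.
rewrite /weval; elim: w => [|[i b] w IH]; first by rewrite big_nil.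
rewrite big_cons IH /=.
have -> : (if b then (pgen i)^-1 else pgen i) = pg_class [:: (i, b)].
  by case: b; rewrite // /pgen [LHS]pg_inv_class.
exact: pg_mul_class.
Qed.

Lemma weval_repr (p : pgroup) : p = weval pgen (repr p).
Proof. by rewrite weval_pgen pg_reprK. Qed.

Lemma weval_rel r : R r -> weval pgen r = 1.
Proof. by move=> Rr; rewrite weval_pgen; apply/pg_classP/wequiv_rel. Qed.

Section Lift.
Variables (G : groupType) (x : I -> G).

Lemma weval_cat u v : weval x (u ++ v) = weval x u * weval x v.
Proof. by rewrite /weval big_cat. Qed.

Hypothesis xR : forall r, R r -> weval x r = 1.

Lemma weval_wequiv u v : wequiv R u v -> weval x u = weval x v.
Proof.
elim=> {u v} [//|u v _ ->//|u v w _ -> _ ->//|u u' v v' _ e1 _ e2|i b|r /xR ->].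
- by rewrite !weval_cat e1 e2.
- by rewrite /weval !big_cons big_nil mulg1; case: b; rewrite ?mulVg ?mulgV.
- by rewrite /weval big_nil.
Qed.
End Lift.

(* The morphism out of the presented group sending generator [i] to [x i];
   meaningful when the [x i] satisfy the relators. *)
Definition pg_lift (G : groupType) (x : I -> G) (p : pgroup) : G :=
  weval x (repr p).

Lemma pg_lift_class (G : groupType) (x : I -> G) w :
  (forall r, R r -> weval x r = 1) -> pg_lift x (pg_class w) = weval x w.
Proof. by move=> xR; apply: (weval_wequiv xR); apply: wequiv_repr. Qed.

Lemma pg_lift_gen (G : groupType) (x : I -> G) i :
  (forall r, R r -> weval x r = 1) -> pg_lift x (pgen i) = x i.
Proof. by move=> xR; rewrite pg_lift_class // /weval big_seq1. Qed.

Lemma pg_liftM (G : groupType) (x : I -> G) :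
  (forall r, R r -> weval x r = 1) -> {morph pg_lift x : p q / p * q}.
Proof.
move=> xR p q; rewrite -(pg_reprK p) -(pg_reprK q).
by rewrite [_ * _]pg_mul_class !pg_lift_class // weval_cat.
Qed.

End PresentedGroup.

Lemma morph_weval (G K : groupType) (I : Type) (f : G -> K) (x : I -> G) w :
  {morph f : a b / a * b} -> f (weval x w) = weval (f \o x) w.
Proof.
move=> fM.
have f1 : f 1 = 1 by apply: (mulgI (f 1)); rewrite -fM !mulg1.
have fV a : f a^-1 = (f a)^-1.
  by apply: (mulgI (f a)); rewrite -fM !mulgV f1.
rewrite /weval; elim: w => [|[i b] w IH]; first by rewrite !big_nil.
by rewrite !big_cons fM IH /=; case: b; rewrite ?fV.
Qed.

Definition cox_rels (I : Type) (m : I -> I -> nat) : set (word I) :=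
  [set r | exists i j, r = wexp (wgen i ++ wgen j) (m i j)].

Definition string_cox (n : nat) (p : seq nat) (i j : 'I_n) : nat :=
  if i == j then 1%N
  else if j == i.+1 :> nat then nth 2 p i
  else if i == j.+1 :> nat then nth 2 p j
  else 2.

Lemma weval_wexp (G : groupType) (I : Type) (x : I -> G) w n :
  weval x (wexp w n) = weval x w ^+ n.
Proof.
rewrite /wexp; elim: n => [|n IH]; first by rewrite /weval big_nil.
by rewrite /= /weval big_cat -/(weval x w) -/(weval x _) IH expgS.
Qed.

Lemma weval_cox (G : groupType) (I : Type) (x : I -> G) i j n :
  weval x (wexp (wgen i ++ wgen j) n) = (x i * x j) ^+ n.
Proof. by rewrite weval_wexp /weval !big_cons big_nil mulg1. Qed.

Definition subgroup (G : groupType) (K : set G) : Prop :=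
  K 1 /\ forall x y, K x -> K y -> K (x * y^-1).

Definition generated (G : groupType) (A : set G) : set G :=
  smallest (@subgroup G) A.

Definition rcoset (G : groupType) (K : set G) (g : G) : set G :=
  [set k * g | k in K].

Lemma rcosetM (G : groupType) (K : set G) g h :
  rcoset (rcoset K g) h = rcoset K (g * h).
Proof.
apply/seteqP; split=> x /=.
  by case=> _ [k Kk <-] <-; exists k; rewrite ?mulgA.
by case=> k Kk <-; exists (k * g); rewrite ?mulgA //; exists k.
Qed.

Lemma rcoset1 (G : groupType) (K : set G) : rcoset K 1 = K.
Proof.
apply/seteqP; split=> x /=; first by case=> k Kk <-; rewrite mulg1.
by move=> Kx; exists x; rewrite ?mulg1.
Qed.

(* A right action of [K] on [W] by automorphisms, written [u^g]. *)
Record raction (W K : groupType) := RAction {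
  ract :> W -> K -> W;
  ractM : forall g, {morph ract^~ g : u v / u * v};
  ract1 : forall u, ract u 1 = u;
  ractJ : forall u g h, ract (ract u g) h = ract u (g * h)
}.

(* [(u, g)] stands for [u * g], where [g^-1 * u * g = u^g]. *)
Definition sdprod (W K : groupType) (a : raction W K) : Type := (W * K)%type.

Section SemidirectProduct.
Variables (W K : groupType) (a : raction W K).

HB.instance Definition _ := Choice.on (sdprod a).

Definition sd_mul (x y : sdprod a) : sdprod a :=
  (x.1 * a y.1 x.2^-1, x.2 * y.2).
Definition sd_one : sdprod a := (1, 1).
Definition sd_inv (x : sdprod a) : sdprod a := (a x.1^-1 x.2, x.2^-1).

Lemma ract_1 g : a 1 g = 1.
Proof. by apply: (mulgI (a 1 g)); rewrite -ractM !mulg1. Qed.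

Lemma sd_mulA : associative sd_mul.
Proof.
by move=> [u g] [v h] [w k]; rewrite /sd_mul /= ractM ractJ invgM !mulgA.
Qed.

Lemma sd_mul1 : left_id sd_one sd_mul.
Proof. by move=> [u g]; rewrite /sd_mul /= invg1 ract1 !mul1g. Qed.

Lemma sd_mulr1 : right_id sd_one sd_mul.
Proof. by move=> [u g]; rewrite /sd_mul /= ract_1 !mulg1. Qed.

Lemma sd_mulV : left_inverse sd_one sd_inv sd_mul.
Proof. by move=> [u g]; rewrite /sd_mul /= invgK -ractM !mulVg ract_1. Qed.

Lemma sd_mulrV : right_inverse sd_one sd_inv sd_mul.
Proof. by move=> [u g]; rewrite /sd_mul /= ractJ !mulgV ract1 mulgV. Qed.

HB.instance Definition _ :=
  isGroup.Build (sdprod a) sd_mulA sd_mul1 sd_mulr1 sd_mulV sd_mulrV.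

End SemidirectProduct.

Section TwoToThe.
(* [tau] are the distinguished generators of the group of [P]; centrality is
   the only property of the central involution [alpha] the construction uses. *)
Variables (K : groupType) (n : nat) (tau : 'I_n.+1 -> K) (alpha : K).
Hypothesis alphaC : forall g, alpha * g = g * alpha.
Variable s : nat.

Definition vstab : set K := generated (tau @` [set j | j != ord0]).

Definition is_vertex (F : set K) : bool := `[< exists g, F = rcoset vstab g >].
Definition vertex := {F : set K | is_vertex F}.
HB.instance Definition _ := Choice.on vertex.

Lemma vact_subproof (F : vertex) (g : K) : is_vertex (rcoset (val F) g).
Proof.
case: F => F /= /asboolP[h ->]; apply/asboolP; exists (h * g).
exact: rcosetM.
Qed.

Definition vact (F : vertex) (g : K) : vertex := Sub _ (vact_subproof F g).

Lemma base_vertex_subproof : is_vertex vstab.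
Proof. by apply/asboolP; exists 1; rewrite rcoset1. Qed.

Definition base_vertex : vertex := Sub _ base_vertex_subproof.

Lemma vactM F g h : vact (vact F g) h = vact F (g * h).
Proof. by apply: val_inj; apply: rcosetM. Qed.

Lemma vact1 F : vact F 1 = F.
Proof. by apply: val_inj; apply: rcoset1. Qed.

Lemma vact_eq F F' g : (vact F g == vact F' g) = (F == F').
Proof.
apply/eqP/eqP => [e|-> //].
by rewrite -(vact1 F) -(mulgV g) -vactM e vactM mulgV vact1.
Qed.

Definition vcox (F F' : vertex) : nat :=
  if F' == F then 1%N else if F' == vact F alpha then s else 2.

Definition two_W : groupType := pgroup (cox_rels vcox).

Definition sigma (F : vertex) : two_W := pgen (cox_rels vcox) F.

Lemma vcox_act F F' g : vcox (vact F g) (vact F' g) = vcox F F'.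
Proof. by rewrite /vcox vactM -alphaC -vactM !vact_eq. Qed.

Lemma sigma_act_rel g r :
  cox_rels vcox r -> weval (fun F => sigma (vact F g)) r = 1.
Proof.
case=> F [F' ->]; rewrite weval_cox -(vcox_act F F' g) -weval_cox.
by apply: weval_rel; exists (vact F g), (vact F' g).
Qed.

Definition wact (u : two_W) (g : K) : two_W := pg_lift (fun F => sigma (vact F g)) u.

Lemma wact_sigma F g : wact (sigma F) g = sigma (vact F g).
Proof. exact: pg_lift_gen (@sigma_act_rel g). Qed.

Lemma wactM g : {morph wact^~ g : u v / u * v}.
Proof. exact: pg_liftM (@sigma_act_rel g). Qed.

Lemma wact_weval g w : wact (weval sigma w) g = weval (fun F => sigma (vact F g)) w.
Proof.
rewrite (morph_weval _ _ (@wactM g)); congr (weval _ w).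
by apply/funext => F /=; rewrite wact_sigma.
Qed.

Lemma wact1 u : wact u 1 = u.
Proof.
rewrite [in RHS](weval_repr u) {1}(weval_repr u) wact_weval.
by congr (weval _ _); apply/funext => F; rewrite vact1.
Qed.

Lemma wactJ u g h : wact (wact u g) h = wact u (g * h).
Proof.
rewrite (weval_repr u) !wact_weval (morph_weval _ _ (@wactM h)).
by congr (weval _ _); apply/funext => F /=; rewrite wact_sigma vactM.
Qed.

Definition wract : raction two_W K := RAction wactM wact1 wactJ.

Definition two_group : groupType := sdprod wract.

Definition rho (i : 'I_n.+2) : two_group :=
  if unlift ord0 i is Some j then (1, tau j) else (sigma base_vertex, 1).

End TwoToThe.

(* A sound but incomplete procedure for equality of words in a Coxeter group;
   its only use is the centrality of [alpha335]. *)
Section Braid.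
Variables (I : eqType) (G : groupType) (x : I -> G) (m : I -> I -> nat).
Hypothesis x_sq : forall i, x i * x i = 1.
Hypothesis x_m : forall i j, (x i * x j) ^+ m i j = 1.

Let ev (w : seq I) : G := \prod_(i <- w) x i.

Fixpoint alt k (i j : I) : seq I := if k is k'.+1 then i :: alt k' j i else [::].

Fixpoint peel (f : I -> seq I -> option (seq I)) k i j w :=
  if k is k'.+1 then obind (peel f k' j i) (f i w) else Some w.

(* [pull n i w = Some v] only if the braid relations turn [w] into [i :: v]. *)
Fixpoint pull n (i : I) (w : seq I) : option (seq I) :=
  if n isn't n'.+1 then None else
  if w isn't j :: w' then None else
  if i == j then Some w' else
  if m i j isn't k.+1 then None else
  omap (cat (alt k j i)) (peel (pull n') k i j w').

Fixpoint braid_eq n (u v : seq I) : bool :=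
  if u isn't i :: u' then v == [::] else
  if pull n i v is Some v' then braid_eq n u' v' else false.

Lemma ev_cat u v : ev (u ++ v) = ev u * ev v.
Proof. by rewrite /ev big_cat. Qed.

Lemma ev_cons i w : ev (i :: w) = x i * ev w.
Proof. by rewrite /ev big_cons. Qed.

Lemma alt_braid i j : ev (alt (m i j) i j) = ev (alt (m i j) j i).
Proof.
have ev_alt k a b : ev (alt k a b) * ev (rev (alt k b a)) = (x a * x b) ^+ k.
  elim: k a b => [|k IH] a b /=; first by rewrite /ev big_nil mulg1.
  rewrite rev_cons -cats1 ev_cat ev_cons [ev [:: b]]big_seq1.
  rewrite -[_ * _ * _]mulgA [ev _ * (_ * _)]mulgA IH.
  elim: k {IH} => [|k IH]; first by rewrite mul1g.
  rewrite expgS -!mulgA IH !expgS; first by rewrite !mulgA.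
have ev_rev w : ev w * ev (rev w) = 1.
  elim: w => [|a w IH]; first by rewrite /ev big_nil mulg1.
  rewrite rev_cons -cats1 ev_cat ev_cons [ev [:: a]]big_seq1.
  by rewrite -mulgA [ev w * _]mulgA IH mul1g x_sq.
apply: (mulIg (ev (rev (alt (m i j) j i)))).
by rewrite ev_alt ev_rev x_m.
Qed.

Lemma pullP n i w v : pull n i w = Some v -> ev w = x i * ev v.
Proof.
elim: n i w v => [//|n IH] i [//|j w] v /=.
case: eqP => [-> [<-]|/eqP ij]; first by rewrite ev_cons.
have peelP k a b u u' :
    peel (pull n) k a b u = Some u' -> ev u = ev (alt k a b) * ev u'.
  elim: k a b u => [|k IHk] a b u /=; first by case=> ->; rewrite [ev [::]]big_nil mul1g.
  case E: (pull n a u) => [u1|//] /= /IHk e.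
  by rewrite (IH _ _ _ E) e ev_cons mulgA.
case mij: (m i j) => [//|k].
case E: (peel _ _ _ _ _) => [u|//] /= [<-].
rewrite ev_cons (peelP _ _ _ _ _ E) ev_cat !mulgA -!ev_cons.
by have := alt_braid i j; rewrite mij => /= ->.
Qed.

Lemma braid_eqP n u v : braid_eq n u v -> ev u = ev v.
Proof.
elim: u v => [|i u IH] v /=; first by move=> /eqP ->.
by case E: (pull n i v) => [v'|//] /IH e; rewrite (pullP E) ev_cons e.
Qed.

Lemma braid_comm n i w v : pull n i w = Some v -> braid_eq n (rcons v i) w ->
  x i * ev w = ev w * x i.
Proof.
move=> /pullP e /braid_eqP; rewrite -cats1 ev_cat [ev [:: i]]big_seq1 => e'.
by rewrite {1}e mulgA x_sq mul1g -e' -mulgA x_sq mulg1.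
Qed.

End Braid.

Definition G335 : groupType := pgroup (cox_rels (@string_cox 4 [:: 3; 3; 5])).
Definition tau335 (i : 'I_4) : G335 := pgen _ i.
Definition alpha335 : G335 := (\prod_(i < 4) tau335 i) ^+ 15.

Lemma tau335_rel i j : (tau335 i * tau335 j) ^+ string_cox [:: 3; 3; 5] i j = 1.
Proof. by rewrite -weval_cox; apply: weval_rel; exists i, j. Qed.

Lemma tau335_sq i : tau335 i * tau335 i = 1.
Proof. by have := tau335_rel i i; rewrite /string_cox eqxx. Qed.

Lemma alpha335_tau i : commute (tau335 i) alpha335.
Proof.
pose I4 : seq 'I_4 := [:: @Ordinal 4 0 isT; @Ordinal 4 1 isT;
                          @Ordinal 4 2 isT; @Ordinal 4 3 isT].
pose w := flatten (nseq 15 I4).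
have -> : alpha335 = \prod_(j <- w) tau335 j.
  have -> : alpha335 = (\prod_(j <- I4) tau335 j) ^+ 15.
    congr (_ ^+ 15); rewrite !big_ord_recl big_ord0 !big_cons big_nil.
    by congr (tau335 _ * (tau335 _ * (tau335 _ * (tau335 _ * _)))); apply: val_inj.
  rewrite /w; elim: 15 => [|k IH]; first by rewrite big_nil.
  have -> : flatten (nseq k.+1 I4) = I4 ++ flatten (nseq k I4) by [].
  by rewrite big_cat expgS IH.
pose ok j := if pull (string_cox [:: 3; 3; 5]) 61 j w is Some v
             then braid_eq (string_cox [:: 3; 3; 5]) 61 (rcons v j) w else false.
have : ok i.
  have : all ok I4 by vm_compute.
  move/allP; apply; rewrite !inE.
  by case: i => [[|[|[|[|//]]]] ?].
rewrite /ok; case E: (pull _ _ _ _) => [v|//].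
by move=> e; apply: (braid_comm tau335_sq tau335_rel E e).
Qed.

Lemma alpha335_central g : alpha335 * g = g * alpha335.
Proof.
rewrite (weval_repr g); apply: commute_prod => -[i b] _ /=.
have Ci : commute alpha335 (tau335 i) by apply/commute_sym/alpha335_tau.
by case: b; [apply: (commuteV Ci)|].
Qed.

Definition G_two335 (s : nat) : groupType := two_group tau335 alpha335_central s.
Definition rho335 (s : nat) (i : 'I_5) : G_two335 s := rho tau335 alpha335_central s i.

Record incidence_system (I : Type) := IncidenceSystem {
  elt :> Type;
  etype : elt -> I;
  inc : elt -> elt -> Prop
}.

Section Hypertope.
Variables (I : Type) (Gam : incidence_system I).
Implicit Types (F C : set Gam) (phi : Gam -> Gam).

Definition incidence_axioms : Prop :=
  [/\ forall x : Gam, inc x x,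
      forall x y : Gam, inc x y -> inc y x &
      forall x y : Gam, inc x y -> etype x = etype y -> x = y].

Definition flag F : Prop := forall x y, F x -> F y -> inc x y.

Definition types F : set I := (@etype I Gam) @` F.

Definition chamber F : Prop := flag F /\ types F = setT.

Definition geometry : Prop :=
  forall F, flag F -> exists2 C, chamber C & F `<=` C.

Definition thin : Prop :=
  forall F i, flag F -> types F = ~` [set i] ->
  exists C C', C <> C' /\
    forall D, chamber D /\ F `<=` D <-> D = C \/ D = C'.

Definition residue F : set Gam :=
  [set x | ~ F x /\ forall y, F y -> inc x y].

Definition inc_connected (A : set Gam) : Prop :=
  forall x y, A x -> A y ->
  clos_refl_trans _ (fun u v => [/\ A u, A v & inc u v]) x y.

Definition residually_connected : Prop :=
  forall F, flag F ->
  (exists i j, [/\ i <> j, ~ types F i & ~ types F j]) ->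
  inc_connected (residue F).

Definition automorphism phi : Prop :=
  [/\ bijective phi,
      forall x, etype (phi x) = etype x &
      forall x y, inc (phi x) (phi y) <-> inc x y].

Definition flag_transitive : Prop :=
  forall F F', flag F -> flag F' -> types F = types F' ->
  exists2 phi, automorphism phi & phi @` F = F'.

Definition regular_hypertope : Prop :=
  [/\ incidence_axioms, geometry, thin, residually_connected & flag_transitive].

End Hypertope.

Section CosetSystem.
Variables (G : groupType) (I : Type) (H : set G) (Hi : I -> set G).

Definition coset_elt : Type :=
  {x : I * set G | exists2 h, H h & x.2 = rcoset (Hi x.1) h}.

Definition coset_type (x : coset_elt) : I := (sval x).1.
Definition coset_set (x : coset_elt) : set G := (sval x).2.

Definition coset_system : incidence_system I :=
  IncidenceSystem coset_type (fun x y => coset_set x `&` coset_set y !=set0).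

Definition induces (h : G) (phi : coset_system -> coset_system) : Prop :=
  forall x, coset_type (phi x) = coset_type x /\
            coset_set (phi x) = rcoset (coset_set x) h.

(* Right multiplication identifies [H] with the group of all type-preserving
   automorphisms, the product [g * h] being [g] followed by [h]. *)
Definition automorphism_group_is_H : Prop :=
  (forall h, H h -> exists2 phi, automorphism phi & induces h phi) /\
  (forall phi, automorphism phi -> exists! h, H h /\ induces h phi).

End CosetSystem.

Section Halving.
Variables (G : groupType) (n : nat) (r : 'I_n.+2 -> G).

Definition halving_gen (i : 'I_n.+2) : G :=
  if i == ord0 then r ord0 * r (lift ord0 ord0) * r ord0 else r i.

Definition halving_group : set G := generated (range halving_gen).

Definition halving_parabolic (i : 'I_n.+2) : set G :=
  generated (halving_gen @` [set j | j != i]).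

Definition halving_system : incidence_system 'I_n.+2 :=
  coset_system halving_group halving_parabolic.

End Halving.

(* [x] generates [H], and a word is trivial in [H] iff it lies in the normal
   closure of [R] in the free group on [I]. *)
Definition presented_by (G : groupType) (I : Type) (H : set G) (x : I -> G)
    (R : set (word I)) : Prop :=
  H = generated (range x) /\
  forall w, weval x w = 1 <-> wequiv R w [::].

(* Generator [0] is [rho~_0], generator [i > 0] is [rho_i]. *)
Definition halving_cox335 (i j : 'I_5) : nat :=
  if i == j then 1%N else
  match minn i j, maxn i j with
  | 0, 2 | 1, 2 | 2, 3 => 3
  | 3, 4 => 5
  | _, _ => 2
  end.

Definition beta : word 'I_5 :=
  wgen (@Ordinal 5 1 isT) ++ wgen (@Ordinal 5 2 isT) ++
  wgen (@Ordinal 5 3 isT) ++ wgen (@Ordinal 5 4 isT).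

Definition betat : word 'I_5 :=
  wgen (@Ordinal 5 0 isT) ++ wgen (@Ordinal 5 2 isT) ++
  wgen (@Ordinal 5 3 isT) ++ wgen (@Ordinal 5 4 isT).

Definition extra_rels (s : nat) : set (word 'I_5) :=
  [set r | exists2 i, i \in [:: 4; 6; 7; 9; 10; 12] &
           r = wexp (wexp (winv betat) i ++ wexp beta i) 2] `|`
  [set wexp (wexp betat 15 ++ wexp beta 15) s].

(* Main.v *)
From HB Require Import structures.
From mathcomp Require Import all_boot.
From mathcomp Require Import boolp classical_sets functions cardinality.
From mathcomp Require Import ssralg ssrint zmodp perm zify ring.
From Stdlib Require Import Relation_Operators.
Require Import Defs.

Set Implicit Arguments.
Unset Strict Implicit.
Unset Printing Implicit Defensive.

Import GRing.Theory.

Local Open Scope classical_set_scope.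
Local Open Scope card_scope.
Local Open Scope group_scope.

(**
Let [K] be the group [3,3,5] of the 600-cell and [W] the Coxeter group on its
vertices, so that the polytope has the group [W : K].

The group [K] is only known through its presentation, and everything needed
about it is read off from the reflection representation, played as a numbers
game ([fire]). For [a <= b] the orbit of the fundamental weight [a] under
[<tau_a, ..., tau_b>] is enumerated together with a word leading to each point;
braid moves certify inside the presented group that these words represent all
cosets of [<tau_(a+1), ..., tau_b>] ([transv_decomp]). Hence stabilizers of
weights are parabolic ([stab_weight]), which gives the intersection property
([meet_parabolic335]), the order 14400 ([elements335]) and the identification
of the 120 vertices with the orbit of the first weight ([vact335_eq]); finally,
the stabilizer of the base vertex has nine orbits on the vertices, represented
by powers of the Coxeter element ([suborbits]).

The group [W] is the direct product of 60 dihedral groups of order [2 * s], one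
for each antipodal pair. Each of them is detected by its regular action on the
cycle of length [2 * s] ([rotor]), which yields the order of [W]
([two_W_elements]) and shows that no [sigma F] is generated by the others
([sigma_separated]).

For a group generated by involutions, the coset geometry of the maximal
parabolic subgroups is a regular hypertope with the expected automorphism group
as soon as intersections of parabolic subgroups are parabolic and pairwise
meeting cosets have a common point ([coset_regular_hypertope],
[coset_automorphism_group]). Both properties hold for the halving group
([meet_halving], [meet_cosets_halving]): a node [i >= 2] separates the diagram,
so that flags can be handled one type at a time as in a string diagram. Only
the two nodes 0 and 1, which are not separated by any node, call for the
geometry: if the edge between two vertices of the polytope lies in a face, then
[sigma_separated] puts its direction into the corresponding simplex.

The halving group is the kernel of the parity of the number of factors
[sigma F], which gives its order ([halving_order]).

For the presentation, let [P] be the presented group. The relators are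
invariant, up to inversion and cyclic rotation, under the exchange of the
generators 0 and 1, so [P] extends to a group [P : <zeta>] in which [zeta]
performs this exchange. Sending [sigma F], for [F] the image of the base vertex
under [g], to the conjugate of [zeta] by [g] defines a morphism from [W : K] to
[P : <zeta>]; by transitivity and the nine suborbits, the relations of [W] need
only be checked for the base vertex and its images under the listed powers of
the Coxeter element, where they amount to the extra relators ([zeta_conj_cox]) or, for adjacent vertices,
to the commutation of the generators 0 and 1 ([Bt_B_sq]). This morphism is a left
inverse of the natural map from [P] to the halving group, which is therefore
injective ([halving_presented]).
*)

(** * Generated subgroups *)

Section Generated.
Variable G : groupType.
Implicit Types (A B K : set G) (x y : G).

Lemma subgroup1 K : subgroup K -> K 1. Proof. by case. Qed.

Lemma subgroupV K x : subgroup K -> K x -> K x^-1.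
Proof. by case=> K1 KB Kx; rewrite -[x^-1]mul1g; apply: KB. Qed.

Lemma subgroupM K x y : subgroup K -> K x -> K y -> K (x * y).
Proof.
move=> sK Kx Ky; rewrite -[y]invgK; case: (sK) => _; apply=> //.
exact: subgroupV.
Qed.

Lemma generated_subgroup A : subgroup (generated A).
Proof.
split; first by move=> K [sK _]; case: sK.
move=> x y Ax Ay K KA; case: (KA) => -[_ KB] _.
by apply: KB; [apply: Ax|apply: Ay].
Qed.

Lemma mem_generated A x : A x -> generated A x.
Proof. by move=> Ax K [_]; apply. Qed.

Lemma generated_min A K : subgroup K -> A `<=` K -> generated A `<=` K.
Proof. by move=> sK AK x; apply. Qed.

Lemma generatedS A B : A `<=` B -> generated A `<=` generated B.
Proof.
move=> AB; apply: generated_min; first exact: generated_subgroup.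
by move=> x /AB; apply: mem_generated.
Qed.

Lemma generated1 A : generated A 1.
Proof. exact: subgroup1 (generated_subgroup A). Qed.

Lemma generatedV A x : generated A x -> generated A x^-1.
Proof. exact: subgroupV (generated_subgroup A). Qed.

Lemma generatedM A x y : generated A x -> generated A y -> generated A (x * y).
Proof. exact: subgroupM (generated_subgroup A). Qed.

Lemma generated_set0 x : generated set0 x -> x = 1.
Proof.
apply: (@generated_min set0 [set 1]) => //.
by split=> // y z -> ->; rewrite /= mulgV.
Qed.

(** As the generators are involutions, their inverses need no separate step. *)
Lemma generated_ind A (P : G -> Prop) :
  (forall a, A a -> a * a = 1) -> P 1 ->
  (forall x a, generated A x -> P x -> A a -> P (x * a)) ->
  forall x, generated A x -> P x.
Proof.
move=> A2 P1 PM.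
suff sP : generated A `<=` [set y | generated A y /\
    forall x, generated A x -> P x -> P (x * y) /\ P (x * y^-1)].
  by move=> x /sP[_ /(_ 1)[||]//]; [exact: generated1|rewrite mul1g].
apply: generated_min => [|a Aa].
  split=> [|y z [Ay Py] [Az Pz]].
    by split=> [|x _ Px]; [exact: generated1|rewrite invg1 mulg1].
  split=> [|x Ax Px]; first by apply: generatedM => //; apply: generatedV.
  rewrite invgM invgK !mulgA; split.
    by case: (Pz (x * y)) => //; [exact: generatedM|case: (Py x)].
  by case: (Py (x * z)) => //; [exact: generatedM|case: (Pz x)].
split=> [|x Ax Px]; first exact: mem_generated.
have -> : a^-1 = a by apply/(mulgI a); rewrite mulgV A2.
by split; apply: PM.
Qed.

(** Commutation passes from the generators to the generated subgroups, so the
set of products is itself a subgroup. *)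
Lemma generatedU A B :
  (forall a b, A a -> B b -> commute a b) ->
  forall x, generated (A `|` B) x ->
  exists y z, [/\ generated A y, generated B z, x = y * z & commute y z].
Proof.
move=> cAB.
have cen (C D : set G) : (forall c d, C c -> D d -> commute c d) ->
    forall c d, C c -> generated D d -> commute c d.
  move=> cCD c d Cc; apply: (generated_min (K := [set d | commute c d])).
    split=> [|u v cu cv]; first exact: commute1.
    by apply: commuteM => //; apply: commuteV.
  by move=> d' Dd'; apply: cCD.
have cgg y z : generated A y -> generated B z -> commute y z.
  apply: (cen (generated A) B) => a b Aa Bb; apply: commute_sym.
  by apply: (cen B A) Bb Aa => b' a' Bb' Aa'; apply/commute_sym/cAB.
apply: generated_min => [|x [Ax|Bx]].
- split=> [|x x' [y [z [Ay Bz -> _]]] [y' [z' [Ay' Bz' -> _]]]].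
    by exists 1, 1; split; rewrite ?mulg1 //; exact: generated1.
  exists (y * y'^-1), (z * z'^-1); split.
  + by apply: generatedM => //; apply: generatedV.
  + by apply: generatedM => //; apply: generatedV.
  + rewrite invgM -!mulgA; congr (y * _); rewrite mulgA; apply/esym/cgg.
      exact: generatedV.
    by apply: generatedM => //; apply: generatedV.
  + apply: cgg; first by apply: generatedM => //; apply: generatedV.
    by apply: generatedM => //; apply: generatedV.
- exists x, 1; split; rewrite ?mulg1 //; last exact: commute1.
    exact: mem_generated.
  exact: generated1.
- exists 1, x; split; rewrite ?mul1g //; last exact/commute_sym/commute1.
    exact: generated1.
  exact: mem_generated.
Qed.

Lemma rcoset_id K x : subgroup K -> rcoset K x x.
Proof. by move=> sK; exists 1; rewrite ?mul1g //; exact: subgroup1. Qed.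

Lemma rcosetP K x y : rcoset K x y <-> K (y * x^-1).
Proof.
split=> [[k Kk <-]|Kyx]; first by rewrite -mulgA mulgV mulg1.
by exists (y * x^-1); rewrite // -mulgA mulVg mulg1.
Qed.

Lemma rcoset_eqP K x y : subgroup K -> rcoset K x = rcoset K y <-> K (x * y^-1).
Proof.
move=> sK; split=> [e|Kxy].
  by apply/rcosetP; rewrite -e; apply: rcoset_id.
apply/seteqP; split=> z /rcosetP Kz; apply/rcosetP.
  rewrite -[z](mulgVK x) -mulgA.
  exact: subgroupM.
rewrite -[z](mulgVK y) -mulgA; apply: subgroupM => //.
by rewrite -[y * _]invgK invgM invgK; apply: subgroupV.
Qed.

End Generated.

Lemma morph1_group (G K : groupType) (f : G -> K) :
  {morph f : x y / x * y} -> f 1 = 1.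
Proof. by move=> fM; apply: (mulgI (f 1)); rewrite -fM !mulg1. Qed.

Lemma morphV_group (G K : groupType) (f : G -> K) :
  {morph f : x y / x * y} -> {morph f : x / x^-1}.
Proof.
by move=> fM x; apply: (mulgI (f x)); rewrite -fM !mulgV (morph1_group fM).
Qed.

Lemma generated_morph (G K : groupType) (f : G -> K) (A : set G) x :
  {morph f : x y / x * y} -> generated A x -> generated (f @` A) (f x).
Proof.
move=> fM; apply: (generated_min (K := [set x | generated (f @` A) (f x)])).
  split=> [|y z Ay Az] /=; first by rewrite (morph1_group fM); exact: generated1.
  by rewrite fM (morphV_group fM); apply: generatedM => //; apply: generatedV.
by move=> a Aa; apply: mem_generated; exists a.
Qed.

Lemma generated_indl (G : groupType) (A : set G) (P : G -> Prop) :
  (forall a, A a -> a * a = 1) -> P 1 ->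
  (forall x a, generated A x -> P x -> A a -> P (a * x)) ->
  forall x, generated A x -> P x.
Proof.
move=> A2 P1 PM x Ax; rewrite -[x]invgK.
apply: (generated_ind (P := fun x => P x^-1) A2 _ _ (generatedV Ax)) => [|{Ax}x a Ax Px Aa].
  by rewrite invg1.
have -> : (x * a)^-1 = a * x^-1.
  by rewrite invgM; congr (_ * _); apply/(mulgI a); rewrite mulgV A2.
by apply: PM => //; apply: generatedV.
Qed.

Lemma invol_inv (G : groupType) (x : G) : x * x = 1 -> x^-1 = x.
Proof. exact: mulg1_eq. Qed.

Lemma invol_comm (G : groupType) (x y : G) :
  x * x = 1 -> y * y = 1 -> (x * y) ^+ 2 = 1 -> commute x y.
Proof.
by move=> xx yy; rewrite expg2 => /mulg1_eq; rewrite invgM !invol_inv.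
Qed.

Lemma comm_invol (G : groupType) (x y : G) :
  x * x = 1 -> y * y = 1 -> commute x y -> (x * y) ^+ 2 = 1.
Proof. by move=> xx yy cxy; rewrite expgMn // !expg2 xx yy mulg1. Qed.

Lemma weval_winv (G : groupType) (I : choiceType) (x : I -> G) w :
  weval x (winv w) = (weval x w)^-1.
Proof.
elim: w => [|[i b] w IH]; first by rewrite /weval !big_nil invg1.
rewrite winv_cons weval_cat IH [in RHS]/weval big_cons invgM -/(weval x w); congr (_ * _).
by rewrite /weval big_seq1 /=; case: b; rewrite ?invgK.
Qed.

Lemma expg_rot (G : groupType) (a b : G) n : (a * b) ^+ n = 1 -> (b * a) ^+ n = 1.
Proof.
move=> ab; have -> : b * a = (a * b) ^ a by rewrite conjgE !mulgA mulVg mul1g.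
by rewrite -conjXg ab conj1g.
Qed.

Lemma expgV_eq1 (G : groupType) (a : G) n : a ^+ n = 1 -> a^-1 ^+ n = 1.
Proof. by move=> an; rewrite expVgn an invg1. Qed.

Lemma pgroup_ext (I : choiceType) (R : set (word I)) (G : groupType)
    (f g : pgroup R -> G) :
  {morph f : x y / x * y} -> {morph g : x y / x * y} ->
  (forall i, f (pgen R i) = g (pgen R i)) -> f =1 g.
Proof.
move=> fM gM fg u; rewrite (weval_repr u) (morph_weval _ _ fM) (morph_weval _ _ gM).
by congr (weval _ _); apply/funext => i; apply: fg.
Qed.

Lemma card_eq_uniq_seq (T : choiceType) (A : set T) (l : seq T) :
  uniq l -> (forall x, x \in l <-> A x) -> A #= `I_(size l).
Proof.
move=> ul lA; have -> : `I_(size l) = index^~ l @` A.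
  apply/seteqP; split=> [i|_ [x /lA xl <-]]; last by rewrite /= index_mem.
  case: l ul lA => [//|x0 l] ul lA il; exists (nth x0 (x0 :: l) i).
    by apply/lA/mem_nth.
  exact: index_uniq.
rewrite card_eq_sym; apply: inj_card_eq => x y; rewrite !inE => /lA xl /lA yl e.
by rewrite -(nth_index x xl) e nth_index.
Qed.

(** * Coset geometries *)

Section CosetGeometry.
Variables (G : groupType) (I : eqType) (x : I -> G).

Definition parabolic (J : set I) : set G := generated (x @` J).

Local Notation Hmax i := (parabolic [set j | j != i]).
Local Notation H := (generated (range x)).
Local Notation Gam := (coset_system H (fun i => Hmax i)).

Hypothesis x_sq : forall i, x i * x i = 1.
Hypothesis x_neq1 : forall i, x i <> 1.
(** The intersection property, and the property that makes flags correspond to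
the cosets of the parabolic subgroups. *)
Hypothesis meet_parabolic : forall (J : set I) g,
  H g -> (forall j, J j -> Hmax j g) -> parabolic (~` J) g.
Hypothesis meet_cosets : forall (J : set I) (c : I -> G),
  (forall j, J j -> H (c j)) ->
  (forall i j, J i -> J j ->
     exists2 z, rcoset (Hmax i) (c i) z & rcoset (Hmax j) (c j) z) ->
  exists2 g, H g & forall j, J j -> rcoset (Hmax j) (c j) g.

Lemma gens_sq J a : (x @` J) a -> a * a = 1.
Proof. by case=> i _ <-. Qed.

Lemma parabolic_sub J : parabolic J `<=` H.
Proof. by apply: generatedS => _ [i _ <-]; exists i. Qed.

Lemma H_gen i : H (x i). Proof. by apply: mem_generated; exists i. Qed.

Lemma Hmax_gen i j : i != j -> Hmax j (x i).
Proof. by move=> ij; apply: mem_generated; exists i. Qed.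

Lemma Hmax_subgroup i : subgroup (Hmax i).
Proof. exact: generated_subgroup. Qed.

Lemma meet_all_trivial g : H g -> (forall j, Hmax j g) -> g = 1.
Proof.
move=> Hg Mg; have := meet_parabolic (J := setT) Hg (fun j _ => Mg j).
by rewrite /parabolic setCT image_set0; apply: generated_set0.
Qed.

Lemma gen_notin_max i : ~ Hmax i (x i).
Proof.
move=> Mi; apply: (@x_neq1 i); apply: meet_all_trivial => [|j]; first exact: H_gen.
by have [<- //|ij] := eqVneq i j; apply: Hmax_gen.
Qed.

Definition elt_through i h (Hh : H h) : Gam :=
  exist _ (i, rcoset (Hmax i) h) (ex_intro2 _ _ h Hh erefl).

Implicit Types (e : Gam) (F C : set Gam) (J : set I).

Lemma elt_eq e e' : etype e = etype e' -> coset_set e = coset_set e' -> e = e'.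
Proof.
case: e e' => [[i A] p] [[j B] q]; rewrite /= /coset_type /coset_set /= => ij AB.
by subst; congr exist; apply: Prop_irrelevance.
Qed.

Lemma elt_coset e h : coset_set e h -> coset_set e = rcoset (Hmax (etype e)) h.
Proof.
case: e => [[i A] [g Hg /= e]]; rewrite /coset_set /etype /coset_type /= e.
by move=> /rcosetP Kh; apply/esym/rcoset_eqP => //; apply: Hmax_subgroup.
Qed.

Lemma elt_rep e : exists2 h, H h & coset_set e h.
Proof.
case: e => [[i A] [g Hg /= e]]; exists g => //.
by rewrite /coset_set /= e; apply/rcoset_id/Hmax_subgroup.
Qed.

Lemma elt_same e e' h :
  etype e = etype e' -> coset_set e h -> coset_set e' h -> e = e'.
Proof.
move=> tt' eh e'h; apply: elt_eq => //.
by rewrite (elt_coset eh) (elt_coset e'h) tt'.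
Qed.

Lemma elt_sub e h : coset_set e h -> H h.
Proof.
have [g Hg eg] := elt_rep e.
rewrite (elt_coset eg) => /rcosetP Mhg.
by rewrite -[h](mulgVK g); apply: generatedM => //; apply: parabolic_sub Mhg.
Qed.

Lemma elt_mul e h k :
  coset_set e h -> Hmax (etype e) k -> coset_set e (k * h).
Proof. by move=> /elt_coset -> Mk; apply/rcosetP; rewrite mulgK. Qed.

Lemma elt_diff e h k :
  coset_set e h -> coset_set e k -> Hmax (etype e) (k * h^-1).
Proof. by move=> /elt_coset -> /rcosetP. Qed.

Lemma elt_through_mem i h (Hh : H h) : coset_set (elt_through i Hh) h.
Proof. exact/rcoset_id/Hmax_subgroup. Qed.

(** All flags have this form ([flagE]), so a flag amounts to a set of types and
a coset of the corresponding intersection of maximal parabolic subgroups. *)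
Definition through J g : set Gam := [set e : Gam | J (etype e) /\ coset_set (e : coset_elt _ _) g].

Lemma through_flag J g : flag (through J g).
Proof. by move=> e e' [_ eg] [_ e'g]; exists g. Qed.

Lemma types_through J g : H g -> types (through J g) = J.
Proof.
move=> Hg; apply/seteqP; split=> [_ [e [Je _] <-] //|i Ji].
by exists (elt_through i Hg) => //; split=> //; apply: elt_through_mem.
Qed.

Lemma flagE F : flag F -> exists2 g, H g & F = through (types F) g.
Proof.
move=> fF.
have [c cP] : exists c : I -> G, forall e, F e -> coset_set e (c (etype e)).
  pose R i h := forall e, F e -> etype e = i -> coset_set e h.
  suff /choice[c cP] : forall i, exists h, R i h.
    by exists c => e Fe; apply: cP.
  move=> i; have [[e Fe ei]|nF] := pselect (exists2 e, F e & etype e = i).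
    have [h _ eh] := elt_rep e; exists h => e' Fe' e'i.
    have [z [ez e'z]] := fF _ _ Fe Fe'.
    by rewrite -(elt_same _ ez e'z) // ei e'i.
  by exists 1 => e Fe ei; case: nF; exists e.
have [] := @meet_cosets (types F) c.
- by move=> _ [e Fe <-]; apply: elt_sub (cP e Fe).
- move=> _ _ [e Fe <-] [e' Fe' <-].
  have [z [ez e'z]] := fF _ _ Fe Fe'; exists z.
    by rewrite -(elt_coset (cP e Fe)).
  by rewrite -(elt_coset (cP e' Fe')).
move=> g Hg gc; exists g => //; apply/seteqP; split=> e.
  move=> Fe; split; first by exists e.
  by rewrite (elt_coset (cP e Fe)); apply: gc; exists e.
case=> -[e' Fe' ee'] eg.
suff -> : e = e' by [].
apply: (elt_same (esym ee') eg).
by rewrite (elt_coset (cP e' Fe')); apply: gc; exists e'.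
Qed.

Lemma through_subP J J' g h : H g -> J `<=` J' ->
  through J g `<=` through J' h <-> forall j, J j -> Hmax j (h * g^-1).
Proof.
move=> Hg JJ'; split=> [sub j Jj|Mj e [Je eg]].
  have [_ eh] := sub (elt_through j Hg) (conj Jj (elt_through_mem j Hg)).
  exact: elt_diff (elt_through_mem j Hg) eh.
split; first exact: JJ'.
by rewrite -[h](mulgVK g); apply: elt_mul => //; apply: Mj.
Qed.

Lemma chamberP C : chamber C <-> exists2 g, H g & C = through setT g.
Proof.
split=> [[fC tC]|[g Hg ->]].
  by have [g Hg ->] := flagE fC; exists g; rewrite // tC.
by split; [exact: through_flag|exact: types_through].
Qed.

(** The quotient of two points common to all the elements of a flag missing
only the type [i] lies in the parabolic subgroup [{1, x i}]: this is thinness in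
terms of points. *)
Lemma adjacent i g h : H g -> H h ->
  (forall j, j != i -> Hmax j (h * g^-1)) -> h = g \/ h = x i * g.
Proof.
move=> Hg Hh Mj.
have : parabolic (~` [set j | j != i]) (h * g^-1).
  by apply: meet_parabolic => //; apply: generatedM => //; apply: generatedV.
have -> : ~` [set j | j != i] = [set i].
  by apply/seteqP; split=> j /=; [move/negP; rewrite negbK => /eqP|move->; rewrite eqxx].
rewrite /parabolic image_set1 => gen.
suff : [set 1; x i] (h * g^-1).
  by case=> e; [left|right]; rewrite -[h](mulgVK g) e ?mul1g.
apply: generated_ind gen; [by move=> _ ->|by left|].
by move=> _ _ _ [] -> ->; [right; rewrite mul1g|left; rewrite x_sq].
Qed.

Lemma coset_incidence : incidence_axioms Gam.
Proof.
split=> [e|e e' [z [ez e'z]]|e e' [z [ez e'z]] tt'].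
- by have [h _ eh] := elt_rep e; exists h.
- by exists z.
- exact: elt_same ez e'z.
Qed.

Lemma coset_geometry : geometry Gam.
Proof.
move=> F /flagE[g Hg ->]; exists (through setT g); first by apply/chamberP; exists g.
by move=> e [].
Qed.

Lemma coset_thin : thin Gam.
Proof.
move=> F i /flagE[g Hg FE] tF; rewrite FE tF.
have Hxg : H (x i * g) by apply: generatedM => //; apply: H_gen.
exists (through setT g), (through setT (x i * g)); split.
  move=> e; apply: (@gen_notin_max i).
  have [_ exg] : through setT (x i * g) (elt_through i Hg).
    by rewrite -e; split=> //; apply: elt_through_mem.
  by have := elt_diff (elt_through_mem i Hg) exg; rewrite mulgK.
move=> D; split=> [[/chamberP[h Hh ->]]|DE].
  have [+ _] := @through_subP (~` [set i]) setT g h Hg (fun _ _ => Logic.I).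
  move=> /[apply] M.
  have [j ji|->|->] := @adjacent i g h Hg Hh; [|by left|by right].
  by apply: M; apply/eqP.
split; first by apply/chamberP; case: DE => ->; [exists g|exists (x i * g)].
case: DE => ->; first by move=> e [].
apply/through_subP => // j /= ji; rewrite mulgK; apply: Hmax_gen.
by rewrite eq_sym; apply/eqP.
Qed.

(** An element of the residue extends the flag, and the extended flag still has
a common point. *)
Lemma residueP J g e : H g ->
  residue (through J g) e <->
  ~ J (etype e) /\ exists2 k, parabolic (~` J) k & coset_set e (k * g).
Proof.
move=> Hg; split=> [[nFe Fe]|[nJe [k Jk ek]]].
  have nJe : ~ J (etype e).
    move=> Je; apply: nFe; set t := etype e in Je.
    have [z [ez gz]] := Fe (elt_through t Hg) (conj Je (elt_through_mem t Hg)).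
    have -> : e = elt_through t Hg by apply: elt_same ez gz.
    by split=> //; apply: elt_through_mem.
  split=> //.
  have /flagE[h Hh FE] : flag (e |` through J g).
    move=> u v [->|Fu] [->|Fv].
    - by case: coset_incidence.
    - exact: Fe.
    - by case: coset_incidence => _ sym _; apply/sym/Fe.
    - exact: through_flag Fu Fv.
  have Fh u : (e |` through J g) u -> coset_set u h by rewrite FE => -[].
  exists (h * g^-1); last by rewrite mulgVK; apply: Fh; left.
  apply: meet_parabolic => [|j Jj]; first by apply: generatedM => //; apply: generatedV.
  have gj := elt_through_mem j Hg.
  by apply: (elt_diff gj); apply: Fh; right; split.
split=> [[/nJe]//|e' [Je' e'g]]; exists (k * g); split=> //.
apply: elt_mul => //; apply: generatedS Jk => _ [i nJi <-]; exists i => //=.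
by apply/eqP => ie; apply: nJi; rewrite ie.
Qed.

(** Left multiplication by [x a] only changes the coset of type [a]. Along a
word in the generators of the residue, consecutive points are therefore joined
by an element of a missing type other than [a]; there is one because two types
are missing. *)
Lemma coset_residually_connected : residually_connected Gam.
Proof.
move=> F /flagE[g Hg FE]; set J := types F => -[i [j [ij nJi nJj]]].
set R := fun u v : Gam => [/\ residue F u, residue F v & inc u v].
have symR u v : R u v -> R v u.
  by case=> ru rv uv; split=> //; case: coset_incidence => _ sym _; apply: sym.
have symC u v : clos_refl_trans _ R u v -> clos_refl_trans _ R v u.
  elim=> {u v} [u v /symR ?|u|u v w _ uv _ vw]; first exact: rt_step.
    exact: rt_refl.
  exact: rt_trans vw uv.
have resP e : residue F e <-> ~ J (etype e) /\
    exists2 k, parabolic (~` J) k & coset_set e (k * g).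
  by rewrite FE; apply: residueP.
suff main k : parabolic (~` J) k -> forall e, ~ J (etype e) ->
    coset_set e (k * g) -> clos_refl_trans _ R (elt_through i Hg) e.
  move=> u v /resP[nJu [k Jk uk]] /resP[nJv [l Jl vl]].
  by apply: rt_trans (symC _ _ (main k Jk _ nJu uk)) (main l Jl _ nJv vl).
have resi : residue F (elt_through i Hg).
  apply/resP; split=> //; exists 1; first exact: generated1.
  by rewrite mul1g; apply: elt_through_mem.
move=> Jk; elim/generated_indl: Jk => {k} [a|e nJe|k _ Jk IH [a nJa <-] e nJe ek].
- exact: gens_sq.
- rewrite mul1g => eg; apply: rt_step; split=> //.
    by apply/resP; split=> //; exists 1; rewrite ?mul1g //; exact: generated1.
  by exists g; split=> //; apply: elt_through_mem.
have Hkg : H (k * g) by apply: generatedM => //; apply: parabolic_sub Jk.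
have [b nJb ba] : exists2 b, ~ J b & a != b.
  by have [ai|ai] := eqVneq a i; [exists j; rewrite // ai; apply/eqP|exists i].
apply: (rt_trans _ _ _ (elt_through b Hkg)); first by apply: IH => //; apply: elt_through_mem.
have bxk : coset_set (elt_through b Hkg) (x a * (k * g)).
  by apply: elt_mul (elt_through_mem b Hkg) _; apply: Hmax_gen.
apply: rt_step; split; last by exists (x a * (k * g)); split; rewrite // mulgA.
  by apply/resP; split=> //; exists k => //; apply: elt_through_mem.
apply/resP; split=> //; exists (x a * k) => //.
by apply: generatedM => //; apply: mem_generated; exists a.
Qed.

Definition rmul h (Hh : H h) e : Gam :=
  exist _ (etype e, rcoset (coset_set e) h)
    (let: ex_intro2 g Hg eg := svalP e in
     ex_intro2 _ _ (g * h) (generatedM Hg Hh)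
       (etrans (congr1 (fun A => rcoset A h) eg) (rcosetM _ _ _))).

Lemma rmul_mem h (Hh : H h) e k :
  coset_set (rmul Hh e) (k * h) <-> coset_set e k.
Proof.
split=> [[k' ek' /mulIg <-] //|ek]; by exists k.
Qed.

Lemma rmulK h (Hh : H h) (HV : H h^-1) : cancel (rmul Hh) (rmul HV).
Proof.
move=> e; apply: elt_eq => //.
by rewrite /coset_set /= -/(coset_set e) rcosetM mulgV rcoset1.
Qed.

Lemma rmul_aut h (Hh : H h) : automorphism (rmul Hh).
Proof.
have HV := generatedV Hh; split=> //.
  exists (rmul HV); first exact: rmulK.
  have HVV := generatedV HV => e; rewrite -{2}(rmulK HV HVV e).
  by apply: elt_eq => //; rewrite /coset_set /= invgK.
move=> e e'; split=> -[z [ez e'z]].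
  move: ez e'z; rewrite -[z](mulgVK h) => /rmul_mem ez /rmul_mem e'z.
  by exists (z * h^-1).
by exists (z * h); split; apply/rmul_mem.
Qed.

Lemma coset_flag_transitive : flag_transitive Gam.
Proof.
move=> F F' /flagE[g Hg FE] /flagE[g' Hg' FE'] tt'.
have Hh : H (g^-1 * g') by apply: generatedM => //; apply: generatedV.
have HV := generatedV Hh.
exists (rmul Hh); first exact: rmul_aut.
rewrite FE FE' tt'; apply/seteqP; split=> [_ [e [Je eg] <-]|e [Je eg']].
  by split=> //; have /(rmul_mem Hh) := eg; rewrite mulVKg.
exists (rmul HV e); last first.
  by apply: elt_eq => //; rewrite /coset_set /= -/(coset_set e) rcosetM mulVg rcoset1.
have gE : g' * (g^-1 * g')^-1 = g by rewrite invgM invgK mulVKg.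
by split=> //; have /(rmul_mem HV) := eg'; rewrite gE.
Qed.

Theorem coset_regular_hypertope : regular_hypertope Gam.
Proof.
split; [exact: coset_incidence|exact: coset_geometry|exact: coset_thin| |].
  exact: coset_residually_connected.
exact: coset_flag_transitive.
Qed.

Lemma automorphism_chamber phi C : automorphism phi -> chamber C -> chamber (phi @` C).
Proof.
case=> _ phi_t phi_i [fC tC]; split.
  by move=> _ _ [u Cu <-] [v Cv <-]; apply/phi_i/fC.
apply/seteqP; split=> // i _; have : types C i by rewrite tC.
by case=> e Ce <-; exists (phi e); [exists e|].
Qed.

(** An automorphism is determined by the image of the base chamber: thinness
propagates this image from each chamber to the adjacent ones. *)
Lemma automorphism_rmul phi : automorphism phi ->
  exists2 h, H h & forall k, H k -> forall e, coset_set e k -> coset_set (phi e) (k * h).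
Proof.
move=> aphi; have [phi_b phi_t phi_i] := aphi.
have img k : H k -> exists2 h, H h & forall e, coset_set e k -> coset_set (phi e) h.
  move=> Hk; have /(automorphism_chamber aphi)/chamberP[h Hh E] : chamber (through setT k).
    by apply/chamberP; exists k.
  exists h => // e ek.
  have : (phi @` through setT k) (phi e) by exists e.
  by rewrite E => -[].
have [h Hh h1] := img 1 (@generated1 _ _).
exists h => // k Hk; elim/generated_indl: Hk => {k} [a|e|k _ Hk IH [a _ <-] e exk].
- exact: gens_sq.
- by rewrite mul1g; apply: h1.
have Hxk : H (x a * k) by apply: generatedM => //; apply: H_gen.
have Hkh : H (k * h) by apply: generatedM.
have [ta|ta] := eqVneq (etype e) a; last first.
  have ek : coset_set e k.
    rewrite -[k](mulKg (x a)); apply: elt_mul => //.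
    by apply: generatedV; apply: Hmax_gen; rewrite eq_sym.
  rewrite -mulgA; apply: elt_mul; first exact: IH.
  by rewrite phi_t; apply: Hmax_gen; rewrite eq_sym.
have [h' Hh' h'P] := img _ Hxk.
have [j ja|hk|hk] := @adjacent a (k * h) h' Hkh Hh'.
- have kj := elt_through_mem j Hk; have xkj : coset_set (elt_through j Hk) (x a * k).
    by apply: elt_mul => //; apply: Hmax_gen; rewrite eq_sym.
  by have := elt_diff (IH _ kj) (h'P _ xkj); rewrite phi_t.
- have ak := elt_through_mem a Hk.
  have ea : phi (elt_through a Hk) = phi e.
    apply: (@elt_same _ _ (k * h)); [by rewrite !phi_t ta|exact: IH|].
    by rewrite -hk; apply: h'P.
  rewrite -(bij_inj phi_b ea) in exk.
  by have := elt_diff ak exk; rewrite mulgK => /gen_notin_max.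
by rewrite -mulgA -hk; apply: h'P.
Qed.

Lemma coset_automorphism_group : automorphism_group_is_H H (fun i => Hmax i).
Proof.
split=> [h Hh|phi aphi].
  by exists (rmul Hh); [exact: rmul_aut|move=> e].
have [h Hh hP] := automorphism_rmul aphi; have [_ phi_t _] := aphi.
exists h; split=> [|h' [Hh' ind]].
  split=> // e; split; first exact: phi_t.
  have [k Hk ek] := elt_rep e.
  by rewrite (elt_coset (hP _ Hk _ ek)) (elt_coset ek) rcosetM phi_t.
suff : h' * h^-1 = 1 by move/divg1_eq.
apply: meet_all_trivial => [|j]; first by apply: generatedM => //; apply: generatedV.
have H1 : H 1 by exact: generated1.
have e1 := elt_through_mem j H1; have := hP _ H1 _ e1; rewrite mul1g => eh.
have [_ E] := ind (elt_through j H1).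
have eh' : coset_set (phi (elt_through j H1)) h' by rewrite E; exists 1; rewrite ?mul1g.
by have := elt_diff eh eh'; rewrite phi_t.
Qed.

End CosetGeometry.

Lemma parabolic_split (G : groupType) (I : eqType) (x : I -> G) (J A B : set I) g :
  (forall a b, A a -> B b -> commute (x a) (x b)) -> J `<=` A `|` B ->
  parabolic x J g ->
  exists y z, [/\ parabolic x A y, parabolic x B z, g = y * z & commute y z].
Proof.
move=> cAB JAB Jg; apply: generatedU => [_ _ [a Aa <-] [b Bb <-]|]; first exact: cAB.
by rewrite -image_setU; apply: generatedS Jg; apply: image_subset.
Qed.

(** * The numbers game for [3,3,5] *)

(** The pair [(a, b)] encodes [a + b * phi], where [phi ^ 2 = phi + 1]. *)
Definition gold : Type := (int * int)%type.
Definition gadd (x y : gold) : gold := (x.1 + y.1, x.2 + y.2)%R.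
Definition gopp (x : gold) : gold := (- x.1, - x.2)%R.
Definition gphi (x : gold) : gold := (x.2, x.1 + x.2)%R.

Definition config : Type := (gold * gold * gold * gold)%type.

(** The coordinates are those of a vector in the basis of the fundamental
weights, and [fire p k] is the image of [p] under the simple reflection [k]. The
bond of order 5 contributes the factor [2 * cos (pi / 5) = phi]. *)
Definition fire (p : config) (k : 'I_4) : config :=
  let: (x0, x1, x2, x3) := p in
  match val k with
  | 0 => (gopp x0, gadd x1 x0, x2, x3)
  | 1 => (gadd x0 x1, gopp x1, gadd x2 x1, x3)
  | 2 => (x0, gadd x1 x2, gopp x2, gadd x3 (gphi x2))
  | _ => (x0, x1, gadd x2 (gphi x3), gopp x3)
  end.

(* An unfolded iterated firing has exponentially large coordinates. *)
Arguments fire : simpl never.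

Definition firew (p : config) (w : word 'I_4) : config :=
  foldl (fun q a => fire q a.1) p w.

Definition I4 : seq 'I_4 := [:: @Ordinal 4 0 isT; @Ordinal 4 1 isT;
                                @Ordinal 4 2 isT; @Ordinal 4 3 isT].

Lemma I4E : I4 = enum 'I_4.
Proof. by apply: (inj_map val_inj); rewrite val_enum_ord. Qed.

Lemma mem_I4 i : i \in I4. Proof. by rewrite I4E mem_enum. Qed.

Ltac case_I4 i := move: (mem_I4 i); rewrite !inE => /or4P[] /eqP ->.

(** Names the coordinates reached after one firing, so that the effect of a word
is described by few linear equations rather than by huge terms. *)
Ltac fire_step :=
  match goal with |- context [fire (?a0, ?b0, (?a1, ?b1), (?a2, ?b2), (?a3, ?b3)) ?k] =>
    let E := fresh in
    case E: (fire (a0, b0, (a1, b1), (a2, b2), (a3, b3)) k) => [[[[? ?] [? ?]] [? ?]] [? ?]];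
    rewrite /fire /= /gadd /gopp /gphi /= in E; case: E => *
  end.

Lemma firew_rel (p : config) r :
  cox_rels (@string_cox 4 [:: 3; 3; 5]) r -> firew p r = p.
Proof.
case=> i [j ->]; move: p => [[[[a0 b0] [a1 b1]] [a2 b2]] [a3 b3]].
case_I4 i; case_I4 j; rewrite /firew /string_cox /wexp /= /foldl /fst.
all: repeat fire_step.
all: repeat (congr pair); lia.
Qed.

Local Notation R335 := (cox_rels (@string_cox 4 [:: 3; 3; 5])).

Lemma firew_wequiv u v : wequiv R335 u v -> forall p, firew p u = firew p v.
Proof.
have cat p u' v' : firew p (u' ++ v') = firew (firew p u') v' by rewrite /firew foldl_cat.
elim=> {u v} [//|u v _ IH p|u v w _ e1 _ e2 p|u u' v v' _ e1 _ e2 p|i b p|r rr p].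
- by rewrite IH.
- by rewrite e1 e2.
- by rewrite !cat e1 e2.
- have /(firew_rel p) : R335 (wexp (wgen i ++ wgen i) 1) by exists i, i; rewrite /string_cox eqxx.
  by [].
- exact: firew_rel.
Qed.

(** The reflection representation as a right action: the simple reflections are
involutions, so letters and inverse letters act alike. *)
Definition dot (p : config) (g : G335) : config := firew p (repr g).

Lemma dot_class p w : dot p (pg_class _ w) = firew p w.
Proof. exact/firew_wequiv/wequiv_repr. Qed.

Lemma dot1 p : dot p 1 = p. Proof. exact: (dot_class p [::]). Qed.

Lemma dotM p g h : dot p (g * h) = dot (dot p g) h.
Proof.
rewrite -[g]pg_reprK -[h]pg_reprK.
have := dot_class p (repr g ++ repr h); rewrite -pg_mul_class => ->.
by rewrite !dot_class /firew foldl_cat.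
Qed.

Lemma dot_tau p i : dot p (tau335 i) = fire p i.
Proof. exact: dot_class. Qed.

(** * Enumeration of orbits, with minimal coset representatives *)

Definition ev (w : seq 'I_4) : G335 := \prod_(i <- w) tau335 i.

Lemma ev_cons k w : ev (k :: w) = tau335 k * ev w.
Proof. exact: big_cons. Qed.

Lemma ev_rcons w k : ev (rcons w k) = ev w * tau335 k.
Proof. by rewrite /ev -cats1 big_cat big_seq1. Qed.

Lemma dot_ev p w : dot p (ev w) = foldl fire p w.
Proof.
elim: w p => [|k w IH] p; first by rewrite /ev big_nil dot1.
by rewrite /ev big_cons dotM dot_tau IH.
Qed.

Definition gens (a b : nat) : seq 'I_4 := [seq k <- I4 | a <= val k <= b].

(** Breadth-first search in which every configuration is stored with the word
that first led to it, a shortest one. *)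
Definition visit (gs : seq 'I_4) (t : config * seq 'I_4) T :=
  foldl (fun T k => let q := fire t.1 k in
    if q \in unzip1 T then T else rcons T (q, rcons t.2 k)) T gs.

Fixpoint explore n i gs T :=
  if n is n'.+1 then
    if onth T i is Some t then explore n' i.+1 gs (visit gs t T) else T
  else T.

(* The orbits explored have at most 120 points. *)
Definition orbit gs p := explore 120 0 gs [:: (p, [::])].

(** The fundamental weight of the node [a]. *)
Definition weight (a : nat) : config :=
  let c i : gold := if i == a then (1%:Z, 0%:Z)%R else (0%:Z, 0%:Z)%R in
  (c 0%N, c 1%N, c 2%N, c 3%N).

Local Notation braid_eq335 := (braid_eq (@string_cox 4 [:: 3; 3; 5]) 61).

(** A generator [k] takes a coset of the stabilizer to the coset of a listed
representative. Either [k] fixes the configuration, and the representative [w]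
satisfies [w * k = j * w] for a generator [j] of the stabilizer, or the new
representative is longer or shorter by the letter [k]; both are certified by
braid moves. The fuel 61 exceeds the length of all reduced words, and nested
conditionals avoid testing all pairs of representatives when evaluated by value. *)
Definition closed_at a b (T : seq (config * seq 'I_4)) t k :=
  if fire t.1 k == t.1 then
    has (fun j => braid_eq335 (rcons t.2 k) (j :: t.2)) (gens a.+1 b)
  else has (fun t' => if t'.1 == fire t.1 k then
                        if braid_eq335 (rcons t.2 k) t'.2 then true
                        else braid_eq335 t.2 (rcons t'.2 k)
                      else false) T.

Definition transv_ok a b T :=
  [&& all (fun t => all (closed_at a b T t) (gens a b)) T,
      all (fun t => t.1 == foldl fire (weight a) t.2) T,
      all (fun t => all (mem (gens a b)) t.2) T,
      uniq (unzip1 T) & (weight a, [::]) \in T].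

Lemma transv_exists a b : a < 4 -> b < 4 -> exists T, transv_ok a b T.
Proof.
move=> a4 b4; exists (orbit (gens a b) (weight a)).
have : all (fun a => all (fun b => transv_ok a b (orbit (gens a b) (weight a)))
              (iota 0 4)) (iota 0 4) by vm_compute.
move/allP/(_ a); rewrite mem_iota => /(_ a4).
by move/allP/(_ b); rewrite mem_iota => /(_ b4).
Qed.

Lemma transv_size a : a < 4 ->
  exists2 T, transv_ok a 3 T & size T = nth 0 [:: 120; 12; 5; 2] a.
Proof.
move=> a4.
have : all (fun a => let T := orbit (gens a 3) (weight a) in
    transv_ok a 3 T && (size T == nth 0 [:: 120; 12; 5; 2] a)) (iota 0 4).
  by vm_compute.
move/allP/(_ a); rewrite mem_iota => /(_ a4) /andP[ok /eqP sz].
by exists (orbit (gens a 3) (weight a)).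
Qed.

Definition itv (a b : nat) : set 'I_4 := [set k : 'I_4 | a <= k <= b].
Local Notation parab a b := (parabolic tau335 (itv a b)).

Lemma mem_gens a b k : (k \in gens a b) = (a <= k <= b).
Proof. by rewrite mem_filter mem_I4 andbT. Qed.

Lemma gen335_sq J a : (tau335 @` J) a -> a * a = 1.
Proof. by case=> i _ <-; apply: tau335_sq. Qed.

Section Transversal.
Variables a b : nat.
Variable T : seq (config * seq 'I_4).
Hypothesis ok : transv_ok a b T.

Lemma transv_dot t : t \in T -> dot (weight a) (ev t.2) = t.1.
Proof. by case/and5P: ok => _ /allP H _ _ _ /H /eqP ->; rewrite dot_ev. Qed.

Lemma transv_parab t : t \in T -> parab a b (ev t.2).
Proof.
case/and5P: ok => _ _ /allP H _ _ /H {H}; elim: t.2 => [_|k w IH /andP[kab /IH Pw]].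
  by rewrite /ev big_nil; apply: generated1.
rewrite ev_cons; apply: generatedM Pw; apply: mem_generated; exists k => //.
by have : k \in gens a b := kab; rewrite mem_gens.
Qed.

Lemma transv_uniq : uniq (unzip1 T).
Proof. by case/and5P: ok. Qed.

Lemma transv_inj t t' :
  t \in T -> t' \in T -> t.1 = t'.1 -> t = t'.
Proof.
move: transv_uniq; elim: T => [//|u T' IH] /= /andP[nuT uT].
rewrite !inE => /orP[/eqP ->|tT] /orP[/eqP ->|t'T] // e.
- by case/mapP: nuT; exists t'.
- by case/mapP: nuT; exists t.
- exact: IH.
Qed.

(** The generators permute the cosets represented by [T], whose union is then
the whole group. *)
Lemma transv_decomp x : parab a b x ->
  exists v t, [/\ parab a.+1 b v, t \in T & x = v * ev t.2].
Proof.
case/and5P: ok => /allP clo _ _ _ T0.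
elim/generated_ind => {x} [x||x _ _ [v [t [Vv Tt ->]]] [k kab <-]].
- exact: gen335_sq.
- exists 1, (weight a, [::]); split=> //; first exact: generated1.
  by rewrite mul1g /ev big_nil.
have : k \in gens a b by rewrite mem_gens.
move/allP: (clo t Tt) => /[apply]; rewrite /closed_at.
have brP u w : braid_eq335 u w -> ev u = ev w.
  exact: (@braid_eqP _ _ _ _ tau335_sq tau335_rel 61 u w).
case: ifP => _ /hasP[].
  move=> j; rewrite mem_gens => jab /brP; rewrite ev_rcons ev_cons => e.
  exists (v * tau335 j), t; split=> //; last by rewrite -!mulgA e.
  by apply: generatedM => //; apply: mem_generated; exists j.
move=> t' Tt'; case: eqP => // _; case: ifP => [/brP + _|_ /brP +]; rewrite ev_rcons => e.
  by exists v, t'; split=> //; rewrite -mulgA e.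
by exists v, t'; split=> //; rewrite e -!mulgA tau335_sq mulg1.
Qed.

End Transversal.

Lemma fire_weight a k : a < 4 -> val k != a -> fire (weight a) k = weight a.
Proof.
move=> a4; have : all (fun a => all (fun k : 'I_4 => (val k == a) ||
    (fire (weight a) k == weight a)) I4) (iota 0 4) by vm_compute.
move/allP/(_ a); rewrite mem_iota => /(_ a4) /allP/(_ k (mem_I4 k)).
by case/orP => [->//|/eqP].
Qed.

Lemma dot_parabolic p J x :
  (forall k, J k -> fire p k = p) -> parabolic tau335 J x -> dot p x = p.
Proof.
move=> fixJ; elim/generated_ind => {x} [x||x _ _ IH [k Jk <-]].
- exact: gen335_sq.
- exact: dot1.
- by rewrite dotM IH dot_tau fixJ.
Qed.

Lemma dot_weight a c b x : a < 4 -> a < c -> parab c b x -> dot (weight a) x = weight a.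
Proof.
move=> a4 ac; apply: dot_parabolic => k /andP[ck _]; apply: fire_weight => //.
by rewrite gtn_eqF // (leq_trans ac).
Qed.

(** Distinct representatives move the weight to distinct configurations, so an
element fixing the weight lies in the coset of the empty word. *)
Lemma stab_weight a b x : a < 4 -> b < 4 ->
  parab a b x -> dot (weight a) x = weight a -> parab a.+1 b x.
Proof.
move=> a4 b4 Px; have [T ok] := transv_exists a4 b4.
have [v [t [Vv Tt ->]]] := transv_decomp ok Px.
rewrite dotM (dot_weight _ _ Vv) // (transv_dot ok) // => e.
have T0 : (weight a, [::]) \in T by case/and5P: ok.
have -> : t = (weight a, [::]) by apply: (transv_inj ok).
by rewrite /ev big_nil mulg1.
Qed.

(** An element of [<tau_a, ..., tau_3>] fixes the weights below [a]; this
confines it to smaller and smaller stabilizers inside [<tau_0, ..., tau_b>]. *)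
Lemma meet_intervals a b x : a <= 4 -> b < 4 ->
  parab a 3 x -> parab 0 b x -> parab a b x.
Proof.
move=> a4 b4 Ax Bx.
suff main i : i <= a -> parab i b x by apply: main.
elim: i => [//|i IH] ia; have i4 := leq_trans ia a4.
exact: stab_weight i4 b4 (IH (ltnW ia)) (dot_weight i4 ia Ax).
Qed.

Lemma tau_comm (i j : 'I_4) : i.+1 < j -> commute (tau335 i) (tau335 j).
Proof.
move=> ij; have := tau335_rel i j.
rewrite /string_cox; case: ifP => [/eqP e|_]; first by rewrite e ltnNge leqnSn in ij.
rewrite (gtn_eqF ij) ltn_eqF; last by rewrite ltnS (leq_trans _ (ltnW ij)).
rewrite expg2 => /mulg1_eq; rewrite invgM.
have V k : (tau335 k)^-1 = tau335 k by apply: mulg1_eq; apply: tau335_sq.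
by rewrite !V => e; apply: esym.
Qed.

Lemma le_ord3 (k : 'I_4) : k <= 3.
Proof. by rewrite -ltnS ltn_ord. Qed.

Lemma parab_all x : parab 0 3 x.
Proof.
rewrite (weval_repr x) /weval; elim: (repr x) => [|[j e] w IH].
  by rewrite big_nil; apply: generated1.
rewrite big_cons; apply: generatedM IH.
have Pj : parab 0 3 (tau335 j).
  by apply: mem_generated; exists j => //; rewrite /itv /= le_ord3.
by case: e => //; apply: generatedV.
Qed.

(** Intervals suffice because the diagram is a string: removing the
node [i] splits a parabolic subgroup into commuting factors below and above
[i], and the factor below [i] lies in every maximal parabolic subgroup for a
node above [i]. *)
Lemma meet_parabolic335 (J : set 'I_4) x :
  (forall j, J j -> parabolic tau335 [set k | k != j] x) ->
  parabolic tau335 (~` J) x.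
Proof.
move=> Mx.
(* The nodes are scanned upwards: [i] is the next one, and the elements below
[a] have already been split off. *)
suff main n i a (y : G335) : i + n = 4 -> a <= i ->
    (forall j : 'I_4, a <= j < i -> ~ J j) -> parab a 3 y ->
    (forall j : 'I_4, J j -> i <= j -> parabolic tau335 [set k | k != j] y) ->
    parabolic tau335 (~` J) y.
  apply: (main 4 0 0 x) => //; first exact: parab_all.
  by move=> j Jj _; apply: Mx.
elim: n i a y => [|n IH] i a y.
  rewrite addn0 => i4 ai nJ + _; apply: generatedS => _ [k /andP[ak _] <-].
  by exists k => //; apply: nJ; rewrite ak i4 ltn_ord.
move=> i4 ai nJ Ay My; have lti : i < 4 by rewrite -i4 -[X in X < _]addn0 ltn_add2l.
have i4' : i.+1 + n = 4 by rewrite addSnnS.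
pose oi := Ordinal lti.
have [Ji|nJi] := pselect (J oi); last first.
  apply: (IH i.+1 a) => // [|j /andP[aj]|j Jj ij].
  - exact: leqW.
  - rewrite ltnS leq_eqVlt => /orP[/eqP ji|ji]; last by apply: nJ; rewrite aj.
    by have -> : j = oi by apply: val_inj.
  - by apply: My => //; apply: ltnW.
have [|||u [v [Lu Uv yE _]]] := @parabolic_split _ _ tau335 [set k | k != oi]
    [set k : 'I_4 | k < i] [set k : 'I_4 | i < k] y.
- by move=> j k /= ji ik; apply: tau_comm; apply: leq_trans ik.
- by move=> k /=; rewrite -(inj_eq val_inj) neq_ltn => /orP.
- exact: My.
have Av : parab a 3 v.
  apply: generatedS Uv => _ [k ik <-]; exists k => //.
  by rewrite /itv /= le_ord3 andbT (leq_trans ai (ltnW ik)).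
have Au : parab a 3 u by rewrite -[u](mulgK v) -yE; apply: generatedM => //; apply: generatedV.
have JCu : parabolic tau335 (~` J) u.
  have [i0|ipos] := posnP i.
    by apply: generatedS Lu => _ [k + <-]; rewrite /= i0 ltn0.
  have : parab a i.-1 u.
    apply: meet_intervals => //; [exact: leq_trans ai (ltnW lti)|by rewrite prednK // ltnW|].
    by apply: generatedS Lu => _ [k ki <-]; exists k; rewrite // /itv /= -ltnS prednK.
  apply: generatedS => _ [k /andP[ak ki] <-]; exists k => //.
  by apply: nJ; rewrite ak -(prednK ipos).
rewrite yE; apply: generatedM => //; apply: (IH i.+1 i.+1) => // [j||j Jj ij].
- by case/andP => /leq_ltn_trans /[apply]; rewrite ltnn.
- apply: generatedS Uv => _ [k ik <-]; exists k => //.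
  by rewrite /itv /= ik le_ord3.
- have Mu : parabolic tau335 [set k | k != j] u.
    apply: generatedS Lu => _ [k ki <-]; exists k => //=.
    by rewrite -(inj_eq val_inj) ltn_eqF // (ltn_trans ki).
  rewrite -[v](mulKg u) -yE; apply: generatedM; first exact: generatedV.
  by apply: My => //; apply: ltnW.
Qed.

Lemma vertexP (K : groupType) n (tau : 'I_n.+1 -> K) (F : vertex tau) :
  exists g, F = vact (base_vertex tau) g.
Proof. by case: F => F /[dup] /asboolP[g e] p; exists g; apply: val_inj. Qed.

Lemma vact_base_eq (K : groupType) n (tau : 'I_n.+1 -> K) g h :
  vact (base_vertex tau) g = vact (base_vertex tau) h <-> vstab tau (g * h^-1).
Proof.
have sV : subgroup (vstab tau) by exact: generated_subgroup.
split=> [/(congr1 val) /= /(rcoset_eqP _ _ sV) //|/(rcoset_eqP _ _ sV) e].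
exact: val_inj.
Qed.

Lemma parab_top x : parab 4 3 x -> x = 1.
Proof.
have -> : itv 4 3 = set0 by apply/seteqP; split=> // k /andP[/leq_trans/[apply]].
by rewrite /parabolic image_set0; apply: generated_set0.
Qed.

Lemma faithful335 x : (forall a, a < 4 -> dot (weight a) x = weight a) -> x = 1.
Proof.
move=> fix_x.
suff main a : a <= 4 -> parab a 3 x by apply: parab_top; apply: main.
elim: a => [_|a IH a4]; first exact: parab_all.
by apply: stab_weight => //; [apply: IH; apply: ltnW|apply: fix_x].
Qed.

(** Orbit-stabilizer: the transversal multiplies the list of the stabilizer. *)
Lemma elements_parab a n : a < 4 ->
  (exists E : seq G335, [/\ uniq E, size E = n & forall x, x \in E <-> parab a.+1 3 x]) ->
  exists E : seq G335, [/\ uniq E, size E = (n * nth 0 [:: 120; 12; 5; 2] a)%N &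
    forall x, x \in E <-> parab a 3 x].
Proof.
move=> a4 [E [uE sE EP]]; have [T ok sT] := transv_size a4.
exists [seq v * ev t.2 | v <- E, t <- T]; split.
- apply: allpairs_uniq => //; first exact: map_uniq (transv_uniq ok).
  move=> _ _ /allpairsP[[v t] /= [/EP Pv Tt ->]] /allpairsP[[v' t'] /= [/EP Pv' Tt' ->]] /= e.
  have : t = t'.
    apply: (transv_inj ok) => //.
    have D u s : parab a.+1 3 u -> s \in T -> dot (weight a) (u * ev s.2) = s.1.
      by move=> Pu Ts; rewrite dotM (dot_weight a4 (ltnSn a) Pu) (transv_dot ok).
    by rewrite -(D v t Pv Tt) e D.
  by move: e => /[swap] <- /mulIg ->.
- by rewrite size_allpairs sE sT.
move=> x; split.
  case/allpairsP=> -[v t] /= [/EP Pv Tt ->].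
  apply: generatedM; last exact: (transv_parab ok).
  apply: generatedS Pv => _ [k /andP[ak k3] <-]; exists k => //.
  by rewrite /itv /= k3 (ltnW ak).
move=> /(transv_decomp ok)[v [t [Pv Tt ->]]].
by apply/allpairsP; exists (v, t); split=> //=; apply/EP.
Qed.

Lemma elements335 : exists E : seq G335,
  [/\ uniq E, size E = (72 * 100 * 2)%N & forall x, x \in E].
Proof.
have E4 : exists E : seq G335, [/\ uniq E, size E = 1%N &
    forall x, x \in E <-> parab 4 3 x].
  exists [:: 1]; split=> // x; rewrite inE; split=> [/eqP ->|/parab_top -> //].
  exact: generated1.
have [E [uE sE EP]] := elements_parab (a := 0) isT (elements_parab (a := 1) isT
  (elements_parab (a := 2) isT (elements_parab (a := 3) isT E4))).
by exists E; split=> // x; apply/EP; apply: parab_all.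
Qed.

(** * The Coxeter element and the vertices of the 600-cell *)

Local Notation V0 := (base_vertex tau335).
Local Notation w0 := (weight 0).

Definition cox335 : G335 := ev I4.
Definition cstep (p : config) : config := foldl fire p I4.

Lemma dot_cox p e : dot p (cox335 ^+ e) = iter e cstep p.
Proof.
elim: e => [|e IH]; first exact: dot1.
by rewrite expgSr dotM IH dot_ev.
Qed.

Lemma alpha335E : alpha335 = cox335 ^+ 15.
Proof.
congr (_ ^+ 15); rewrite !big_ord_recl big_ord0 /cox335 /ev !big_cons big_nil.
by congr (tau335 _ * (tau335 _ * (tau335 _ * (tau335 _ * _)))); apply: val_inj.
Qed.

Lemma alpha335_sq : alpha335 * alpha335 = 1.
Proof.
apply: faithful335 => a a4; rewrite alpha335E -expgnDr dot_cox.
have : all (fun a => iter 30 cstep (weight a) == weight a) (iota 0 4) by vm_compute.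
by move/allP/(_ a); rewrite mem_iota => /(_ a4) /eqP.
Qed.

Lemma vstab335 : vstab tau335 = parab 1 3.
Proof.
rewrite /vstab /parabolic; congr (generated (_ @` _)).
apply/seteqP; split=> k; rewrite /itv /= le_ord3 andbT lt0n.
  by apply: contra => /eqP k0; apply/eqP/val_inj.
by apply: contra => /eqP ->.
Qed.

Lemma vact335_eq g h : vact V0 g = vact V0 h <-> dot w0 g = dot w0 h.
Proof.
rewrite vact_base_eq vstab335; split=> [Vgh|e].
  by rewrite -[g](mulgVK h) dotM (dot_weight _ _ Vgh).
apply: stab_weight => //; first exact: parab_all.
by rewrite dotM e -dotM mulgV dot1.
Qed.

Definition antipode : config -> config := iter 15 cstep.

(** One vertex of each antipodal pair, namely the one listed first. *)
Definition upper_half (T : seq (config * seq 'I_4)) :=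
  [seq t <- T | index t.1 (unzip1 T) < index (antipode t.1) (unzip1 T)].

Definition antipodes_ok T :=
  all (fun t => antipode t.1 != t.1) T && (size (upper_half T) == 60).

(** One power for each of the nine possible distances of a vertex from the base
vertex. *)
Definition cox_powers : seq nat := [:: 0; 1; 4; 6; 7; 9; 10; 12; 15]%N.

Definition suborbits_ok (T : seq (config * seq 'I_4)) :=
  all (fun t => has (fun e => has (fun u =>
      [&& u.1 == t.1, all (mem (gens 1 3)) u.2 &
          foldl fire (iter e cstep w0) u.2 == u.1])
    (orbit (gens 1 3) (iter e cstep w0))) cox_powers) T.

Lemma vertices_exist :
  exists T, [/\ transv_ok 0 3 T, antipodes_ok T & suborbits_ok T].
Proof.
exists (orbit (gens 0 3) w0).
by apply/and3P; vm_compute.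
Qed.

Lemma dot_antipode g : dot w0 (g * alpha335) = antipode (dot w0 g).
Proof. by rewrite dotM alpha335E dot_cox. Qed.

Lemma vertex_transv T F : transv_ok 0 3 T ->
  exists2 t, t \in T & F = vact V0 (ev t.2).
Proof.
move=> ok; have [g ->] := vertexP F.
have [v [t [Pv Tt ->]]] := transv_decomp ok (parab_all g).
by exists t => //; apply/vact335_eq; rewrite dotM (dot_weight _ _ Pv).
Qed.

Lemma alpha335_free (F : vertex tau335) : vact F alpha335 <> F.
Proof.
have [T [ok /andP[/allP Tneq _] _]] := vertices_exist.
have [t Tt ->] := vertex_transv F ok.
rewrite vactM => /vact335_eq; rewrite dot_antipode (transv_dot ok Tt).
exact/eqP/Tneq.
Qed.

Lemma alpha335_invol (F : vertex tau335) : vact (vact F alpha335) alpha335 = F.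
Proof. by rewrite vactM alpha335_sq vact1. Qed.

Lemma half_vertices : exists reps : seq (vertex tau335),
  [/\ uniq reps, size reps = 60,
      forall F, F \in reps \/ vact F alpha335 \in reps &
      forall F, F \in reps -> vact F alpha335 \notin reps].
Proof.
have [T [ok /andP[/allP Tneq /eqP s60] _]] := vertices_exist.
pose vtx (t : config * seq 'I_4) : vertex tau335 := vact V0 (ev t.2).
have vtx_inj t t' : t \in T -> t' \in T -> vtx t = vtx t' -> t = t'.
  move=> Tt Tt' /vact335_eq; rewrite !(transv_dot ok) //.
  exact: (transv_inj ok).
have halfT t : t \in upper_half T -> t \in T by rewrite mem_filter => /andP[].
have opp t : t \in T -> exists t', [/\ t' \in T, vact (vtx t) alpha335 = vtx t',
    t'.1 = antipode t.1 & antipode t'.1 = t.1].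
  move=> Tt; have [t' Tt' e] := vertex_transv (vact (vtx t) alpha335) ok.
  have e1 : t'.1 = antipode t.1.
    move: e; rewrite vactM => /vact335_eq.
    by rewrite dot_antipode !(transv_dot ok).
  exists t'; split=> //.
  have : vact (vtx t') alpha335 = vtx t by rewrite /vtx -e alpha335_invol.
  by rewrite vactM => /vact335_eq; rewrite dot_antipode !(transv_dot ok).
exists (map vtx (upper_half T)); split.
- rewrite map_inj_in_uniq ?filter_uniq ?(map_uniq (transv_uniq ok)) //.
  by move=> t t' /halfT Tt /halfT Tt'; apply: vtx_inj.
- by rewrite size_map.
- move=> F; have [t Tt ->] := vertex_transv F ok.
  have [t' [Tt' e e1 e2]] := opp t Tt.
  have [lt|le] := ltnP (index t.1 (unzip1 T)) (index (antipode t.1) (unzip1 T)).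
    by left; apply: map_f; rewrite mem_filter lt.
  right; rewrite e; apply: map_f; rewrite mem_filter Tt' andbT e2 e1.
  rewrite ltn_neqAle le andbT; apply/eqP => /index_inj; rewrite -e1.
  have in1 u : u \in T -> u.1 \in unzip1 T by apply: map_f.
  by move=> /(_ t.1 (in1 _ Tt') (in1 _ Tt)) ee; move: (Tneq t Tt); rewrite -e1 ee eqxx.
move=> F /mapP[t ht ->]; have Tt := halfT t ht.
have [t' [Tt' e e1 e2]] := opp t Tt.
apply/negP; rewrite e => /mapP[u hu /vtx_inj]; have Tu := halfT u hu.
move=> /(_ Tt' Tu) t'u; move: ht hu; rewrite -t'u !mem_filter e2 e1.
by case/andP => lt _ /andP[/ltn_trans/(_ lt)]; rewrite ltnn.
Qed.

(** It is because these double cosets exhaust the group that so few extra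
relators define the halving group. *)
Lemma suborbits g : exists e v,
  [/\ e \in cox_powers, vstab tau335 v & vact V0 g = vact V0 (cox335 ^+ e * v)].
Proof.
have [T [ok _ /allP sub]] := vertices_exist.
have [t Tt ->] := vertex_transv (vact V0 g) ok.
have /hasP[e ee /hasP[u _ /and3P[/eqP ut lu /eqP ue]]] := sub t Tt.
exists e, (ev u.2); split=> //; last first.
  by apply/vact335_eq; rewrite (transv_dot ok Tt) dotM dot_cox dot_ev ue ut.
rewrite vstab335; elim: u.2 lu => [_|k w IH /andP[kab /IH Pw]].
  by rewrite /ev big_nil; apply: generated1.
rewrite ev_cons; apply: generatedM Pw; apply: mem_generated; exists k => //.
by have : k \in gens 1 3 := kab; rewrite mem_gens.
Qed.

Lemma cox_power_neq_alpha e : e \in [:: 4; 6; 7; 9; 10; 12]%N ->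
  vact V0 (cox335 ^+ e) <> vact V0 alpha335.
Proof.
move=> ee; have : all (fun e => iter e cstep w0 != antipode w0)
  [:: 4; 6; 7; 9; 10; 12]%N by vm_compute.
move=> /allP/(_ e ee)/eqP ne.
by rewrite -[alpha335]mul1g => /vact335_eq; rewrite dot_antipode dot_cox dot1.
Qed.

(** * The dihedral reflections *)

Section Reflections.
Variable s : nat.
Hypothesis hs : 2 <= s.
Local Notation Z := 'Z_(2 * s).
Local Open Scope ring_scope.

Lemma refl_inj (c : Z) : injective (fun x => c - x).
Proof. by move=> x y /addrI /oppr_inj. Qed.

Definition refl (c : Z) : {perm Z} := perm (@refl_inj c).

Lemma reflE c x : refl c x = c - x. Proof. exact: permE. Qed.

Lemma refl_sq c : (refl c * refl c = 1)%g.
Proof. by apply/permP => x; rewrite permM !reflE perm1; ring. Qed.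

Lemma Z2s_nat k : (k%:R == 0 :> Z) = (2 * s %| k)%N.
Proof.
have s1 : (1 < 2 * s)%N by lia.
by rewrite -(inj_eq val_inj) /= val_Zp_nat.
Qed.

Lemma refl_rot c d : (d - c) *+ s = 0 -> ((refl c * refl d) ^+ s = 1)%g.
Proof.
move=> cd0.
have rot n x : ((refl c * refl d) ^+ n)%g x = x + (d - c) *+ n.
  elim: n => [|n IH]; first by rewrite perm1 addr0.
  by rewrite expgSr permM IH permM !reflE mulrSr; ring.
by apply/permP => x; rewrite rot cd0 addr0 perm1.
Qed.

End Reflections.

(** * The group of order two *)

Definition sign : Type := bool.
HB.instance Definition _ := Choice.on sign.
HB.instance Definition _ := isGroup.Build sign addbA addFb addbF addbb addbb.

(** * The Coxeter group on the vertices *)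

Section VertexGroup.
Variables (K : groupType) (n : nat) (tau : 'I_n.+1 -> K) (alpha : K).
Variable s : nat.
Hypothesis hs : 2 <= s.
Hypothesis alpha_free : forall F : vertex tau, vact F alpha <> F.
Hypothesis alpha_invol : forall F : vertex tau, vact (vact F alpha) alpha = F.

Local Notation N := (2 * s)%N.
Local Notation W := (two_W tau alpha s).
Local Notation sigma := (@sigma K n tau alpha s).
Local Notation relW := (cox_rels (@vcox K n tau alpha s)).
Implicit Types F : vertex tau.

Lemma sigma_sq F : sigma F * sigma F = 1.
Proof.
have : relW (wexp (wgen F ++ wgen F) (vcox alpha s F F)) by exists F, F.
by move/weval_rel; rewrite weval_cox /vcox eqxx.
Qed.

Lemma sigma_rel F F' : (sigma F * sigma F') ^+ vcox alpha s F F' = 1.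
Proof. by rewrite -weval_cox; apply: weval_rel; exists F, F'. Qed.

Lemma sigma_comm F F' : F' <> vact F alpha -> commute (sigma F) (sigma F').
Proof.
move=> /eqP/negbTE nFa; have [->|/negbTE nF] := eqVneq F' F; first exact: commute_refl.
by have := sigma_rel F F'; rewrite /vcox nF nFa; apply: invol_comm; apply: sigma_sq.
Qed.

Lemma sigma_gen_sq A a : (sigma @` A) a -> a * a = 1.
Proof. by case=> F _ <-; apply: sigma_sq. Qed.

(** The defining relations of [W], sorted by the relative position of the two
vertices. *)
Lemma vcox_lift (G : groupType) (x : vertex tau -> G) :
  (forall F, x F * x F = 1) ->
  (forall F, (x F * x (vact F alpha)) ^+ s = 1) ->
  (forall F F', F' <> F -> F' <> vact F alpha -> (x F * x F') ^+ 2 = 1) ->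
  forall r, relW r -> weval x r = 1.
Proof.
move=> xx xs x2 _ [F [F' ->]]; rewrite weval_cox /vcox.
have [->|/eqP nF] := eqVneq F' F; first exact: xx.
by have [->|/eqP nFa] := eqVneq F' (vact F alpha); [exact: xs|exact: x2].
Qed.

Definition parity : W -> sign := pg_lift (fun _ => true : sign).

Lemma parity_rel r : relW r -> weval (fun _ => true : sign) r = 1.
Proof.
have one k : (1 : sign) ^+ k = 1 by rewrite expg1n.
by apply: vcox_lift => // *; apply: one.
Qed.

Lemma parityM : {morph parity : u v / u * v}.
Proof. exact: pg_liftM parity_rel. Qed.

Lemma parity_sigma F : parity (sigma F) = true.
Proof. exact: pg_lift_gen parity_rel. Qed.

(** The dihedral group of the antipodal pair of [F] acts regularly on the cycle
of length [2 * s]. The length [s] would not do: for [s = 2] both reflections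
would act on it in the same way. *)
Definition rotor F F' : {perm 'Z_(N)} :=
  if F' == F then @refl s 1%R else if F' == vact F alpha then @refl s (-1)%R else 1.

Lemma rotor_sq F F' : rotor F F' * rotor F F' = 1.
Proof. by rewrite /rotor; do 2 (case: ifP => _; first exact: refl_sq); rewrite mulg1. Qed.

Lemma rotor_rel F r : relW r -> weval (rotor F) r = 1.
Proof.
have s2 : (N%:R = 0 :> 'Z_(N))%R by apply/eqP; rewrite (Z2s_nat hs).
have s2' : ((1 + 1) *+ s = 0 :> 'Z_(N))%R by rewrite -mulr2n -mulrnA.
have aF F' : (vact F' alpha == F') = false by apply/eqP/alpha_free.
have aaF F' F'' : (vact F' alpha == F'') = (F' == vact F'' alpha).
  by rewrite -(vact_eq _ _ alpha) alpha_invol.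
apply: vcox_lift => [F'|F'|F' F'' n1 n2]; first exact: rotor_sq.
  have [->|nF] := eqVneq F' F.
    rewrite /rotor eqxx aF eqxx; apply: refl_rot.
    by rewrite -opprD mulNrn s2' oppr0.
  have [->|nFa] := eqVneq F' (vact F alpha).
    rewrite /rotor aF alpha_invol !eqxx; apply: refl_rot.
    by rewrite opprK s2'.
  by rewrite /rotor aaF vact_eq (negbTE nF) (negbTE nFa) mulg1 expg1n.
apply: comm_invol; [exact: rotor_sq|exact: rotor_sq|]; rewrite /rotor.
have [e|nF] := eqVneq F' F.
  move: n1 n2; rewrite e => /eqP/negbTE -> /eqP/negbTE ->; exact: commute1.
have [e|_] := eqVneq F' (vact F alpha); last exact/commute_sym/commute1.
move: n1 n2; rewrite e alpha_invol => /eqP/negbTE n1 /eqP/negbTE n2.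
by rewrite n1 n2; exact: commute1.
Qed.

Definition rotate F : W -> {perm 'Z_(N)} := pg_lift (rotor F).

Lemma rotateM F : {morph rotate F : u v / u * v}.
Proof. exact: pg_liftM (@rotor_rel F). Qed.

Lemma rotate_sigma F F' : rotate F (sigma F') = rotor F F'.
Proof. exact: pg_lift_gen (@rotor_rel F). Qed.

Lemma Z2s_neq0 k : 0 < k < N -> (k%:R != 0 :> 'Z_(N))%R.
Proof.
case/andP=> k0 ks; rewrite (Z2s_nat hs) //.
by apply: contraL ks => /dvdn_leq; rewrite -leqNgt; apply.
Qed.

(** The pair [{0, -1}] of the cycle is stable under every generator but
[sigma F], which moves 0 to 1. *)
Lemma sigma_separated F (A : set (vertex tau)) :
  generated (sigma @` A) (sigma F) -> A F.
Proof.
move=> gF; apply: contrapT => nAF.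
pose ends : set 'Z_(N) := [set 0%R; (-1)%R].
have : ends (rotate F (sigma F) 0%R).
  move: gF; generalize (sigma F) => u; elim/generated_ind => {u} [a||u _ _ IH [F' AF' <-]].
  - exact: sigma_gen_sq.
  - by rewrite (morph1_group (@rotateM F)) perm1; left.
  rewrite rotateM permM rotate_sigma /rotor; case: eqP => [e|_].
    by case: nAF; rewrite -e.
  case: eqP => [_|_]; last by rewrite perm1.
  by rewrite reflE; case: IH => ->; [right; rewrite subr0|left; rewrite opprK addNr].
rewrite rotate_sigma /rotor eqxx reflE subr0 => -[/eqP|/eqP].
  by apply/negP; rewrite -[1%R]/(1%:R%R) Z2s_neq0 //; lia.
rewrite -subr_eq0 opprK => /eqP e.
have /negP[] : (2%:R != 0 :> 'Z_(N))%R by apply: Z2s_neq0; lia.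
by rewrite mulr2n e.
Qed.

Lemma sigma_inj : injective sigma.
Proof.
move=> F F' e; have : generated (sigma @` [set F']) (sigma F).
  by rewrite e; apply: mem_generated; exists F'.
by move/sigma_separated.
Qed.

(** * The order of the Coxeter group on the vertices *)

(** For [m < N] these alternating words run once through the dihedral group of
the antipodal pair of [F]. *)
Fixpoint zigzag F m : W :=
  if m is m'.+1 then zigzag F m' * sigma (if odd m' then vact F alpha else F) else 1.

Lemma zigzag_2s F : zigzag F N = 1.
Proof.
have : (sigma F * sigma (vact F alpha)) ^+ s = 1.
  by have := sigma_rel F (vact F alpha); rewrite /vcox eqxx; case: eqP => // /alpha_free.
suff E k : zigzag F (2 * k)%N = (sigma F * sigma (vact F alpha)) ^+ k by rewrite E.
elim: k => [//|k IH]; rewrite mulnS !addSn /= mul2n odd_double /= -mul2n IH expgSr.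
by rewrite mulgA.
Qed.

Lemma zigzag_next F m (b : bool) : m < N ->
  exists2 m', m' < N & zigzag F m * sigma (if b then vact F alpha else F) = zigzag F m'.
Proof.
move=> ms; have [mb|mb] := eqVneq (odd m) b.
  have [e|ne] := eqVneq m.+1 N; last first.
    by exists m.+1; [rewrite ltn_neqAle ne|rewrite /= mb].
  by exists 0%N; [exact: leq_ltn_trans ms|rewrite -mb -[LHS]/(zigzag F m.+1) e zigzag_2s].
case: m ms mb => [_|m ms].
  case: b => // _; exists N.-1; first by rewrite prednK //; lia.
  apply: (mulIg (sigma (vact F alpha))); rewrite mul1g sigma_sq.
  have : zigzag F N.-1.+1 = 1 by rewrite prednK ?zigzag_2s //; lia.
  have -> : zigzag F N.-1.+1 = zigzag F N.-1 * sigma (vact F alpha).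
    by rewrite /=; suff -> : odd N.-1 by []; lia.
  by move=> ->.
rewrite /= => mb; exists m; first exact: ltnW.
have -> : b = odd m by case: b (odd m) mb => [] [].
by rewrite -mulgA sigma_sq mulg1.
Qed.

(** These images of 0 are all distinct for [m < 2 * s], since [2 * s] is even. *)
Lemma rotate_zigzag F m :
  rotate F (zigzag F m) 0%R = (if odd m then m%:R else - m%:R)%R.
Proof.
elim: m => [|m IH] /=; first by rewrite (morph1_group (@rotateM F)) perm1 oppr0.
rewrite rotateM permM IH rotate_sigma /rotor; case: (odd m) => /=.
  case: eqP => [/alpha_free //|_]; rewrite eqxx reflE mulrS; ring.
by rewrite eqxx reflE opprK mulrS.
Qed.

Lemma rotate_zigzag_inj F m m' : m < N -> m' < N ->
  rotate F (zigzag F m) 0%R = rotate F (zigzag F m') 0%R -> m = m'.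
Proof.
move=> mN m'N; rewrite !rotate_zigzag.
pose lab k := if odd k then k else if k == 0%N then 0%N else (N - k)%N.
have labN k : k < N -> lab k < N by rewrite /lab; case: ifP => // _; case: eqP; lia.
have labE k : k < N -> (if odd k then k%:R else - k%:R)%R = ((lab k)%:R : 'Z_(N))%R.
  move=> kN; rewrite /lab; case: ifP => // _; case: eqP => [->|_]; first by rewrite oppr0.
  apply/eqP; rewrite eq_sym -subr_eq0 opprK -natrD subnK ?(ltnW kN) //.
  by rewrite (Z2s_nat hs).
rewrite !labE // => /(congr1 val); rewrite /= !val_Zp_nat; [|lia|lia].
rewrite !modn_small ?labN // /lab.
by case: (boolP (odd m)) => om; case: (boolP (odd m')) => om'; do ?case: eqP; lia.
Qed.

Definition pairs (r : seq (vertex tau)) : set (vertex tau) :=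
  [set F | F \in r \/ vact F alpha \in r].

Lemma zigzag_mem F m : generated (sigma @` [set F; vact F alpha]) (zigzag F m).
Proof.
elim: m => [|m IH] /=; first exact: generated1.
apply: generatedM IH _; apply: mem_generated.
by exists (if odd m then vact F alpha else F) => //; case: ifP; [right|left].
Qed.

Lemma zigzagP F u : generated (sigma @` [set F; vact F alpha]) u ->
  exists2 m, m < N & u = zigzag F m.
Proof.
elim/generated_ind => {u} [||u _ _ [m mN ->] [F' FF' <-]]; first exact: sigma_gen_sq.
  by exists 0%N => //; lia.
case: FF' => ->; first by have [m' m'N e] := zigzag_next F false mN; exists m'.
by have [m' m'N e] := zigzag_next F true mN; exists m'.
Qed.

(** Each new antipodal pair contributes a dihedral factor commuting with the
previous ones, and its action on the cycle kills those, so that the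
factorization is unique. *)
Lemma two_W_elements (r : seq (vertex tau)) :
  uniq r -> (forall F, F \in r -> vact F alpha \notin r) ->
  exists E : seq W, [/\ uniq E, size E = (N ^ size r)%N &
    forall u, u \in E <-> generated (sigma @` pairs r) u].
Proof.
elim: r => [|F r IH] /=.
  move=> _ _; exists [:: 1]; split=> // u; rewrite inE; split=> [/eqP ->|]; first exact: generated1.
  have -> : pairs [::] = set0 by apply/seteqP; split=> // F [].
  by rewrite image_set0 => /generated_set0 ->.
case/andP=> nFr ur anti.
have anti' F' : F' \in r -> vact F' alpha \notin r.
  move=> F'r; have := anti F'; rewrite !inE F'r orbT negb_or => /(_ isT).
  by case/andP.
have [E [uE sE EP]] := IH ur anti'.
have npairs F' : pairs r F' -> F' <> F /\ F' <> vact F alpha.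
  have nFa : vact F alpha \notin r.
    by have := anti F; rewrite !inE eqxx => /(_ isT); rewrite negb_or => /andP[].
  by case=> rF'; split=> e; move: rF'; rewrite e ?alpha_invol ?(negbTE nFr) ?(negbTE nFa).
have rot1 u : generated (sigma @` pairs r) u -> rotate F u = 1.
  elim/generated_ind => {u} [||u _ _ IHu [F' rF' <-]]; first exact: sigma_gen_sq.
    exact: morph1_group (@rotateM F).
  rewrite rotateM IHu mul1g rotate_sigma /rotor.
  by have [/eqP/negbTE -> /eqP/negbTE ->] := npairs F' rF'.
have pairsE : pairs (F :: r) = [set F; vact F alpha] `|` pairs r.
  apply/seteqP; split=> F2; rewrite /pairs /= !inE.
    case=> [/orP[/eqP ->|?]|/orP[/eqP e|?]]; [by left; left|by right; left| |by right; right].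
    by left; right; rewrite -e alpha_invol.
  case=> [[->|->]|[->|->]]; rewrite ?alpha_invol ?eqxx ?orbT; by [left|right].
exists [seq zigzag F m * u | m <- iota 0 N, u <- E]; split.
- apply: allpairs_uniq => //; first exact: iota_uniq.
  move=> _ _ /allpairsP[[m u] /= [+ /EP Eu ->]] /allpairsP[[m' u'] /= [+ /EP Eu' ->]] /=.
  rewrite !mem_iota !add0n => mN m'N e; have em : m = m'.
    apply: (@rotate_zigzag_inj F) => //.
    by have := congr1 (rotate F) e; rewrite !rotateM (rot1 u Eu) (rot1 u' Eu') !mulg1 => ->.
  by move: e; rewrite em => /mulgI ->.
- by rewrite size_allpairs sE size_iota expnS.
move=> u; rewrite pairsE; split.
  case/allpairsP=> -[m v] /= [_ /EP Ev ->]; apply: generatedM.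
    have := @zigzag_mem F m; apply: generatedS.
    by apply: image_subset => ?; left.
  by apply: generatedS Ev; apply: image_subset => ?; right.
rewrite image_setU => /generatedU[|v [v' [/zigzagP[m mN ->] Ev' -> _]]].
  move=> _ _ [F1 F1F <-] [F2 /npairs[n1 n2] <-]; apply: sigma_comm => e.
  by case: F1F e => -> //; rewrite alpha_invol.
apply/allpairsP; exists (m, v'); split=> //=; first by rewrite mem_iota.
exact/EP.
Qed.

End VertexGroup.

(** * The halving group *)

Section Halving335.
Variable s : nat.
Hypothesis hs : 2 <= s.

Local Notation G := (G_two335 s).
Local Notation W := (two_W tau335 alpha335 s).
Local Notation sigma := (@sigma G335 3 tau335 alpha335 s).
Local Notation V0 := (base_vertex tau335).
Local Notation rhot := (halving_gen (rho335 s)).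
Local Notation H := (generated (range rhot)).
Local Notation par := (parabolic rhot).
Local Notation M i := (par [set j | j != i]).
Local Notation up j := (lift (@ord0 4) j).
Local Notation act := (@wract G335 3 tau335 alpha335 alpha335_central s).

Let sigma_sq' := @sigma_sq G335 3 tau335 alpha335 s.

Lemma mulE (u v : W) (g h : G335) :
  ((u, g) : G) * ((v, h) : G) = (u * act v g^-1, g * h) :> G.
Proof. by []. Qed.

(** The complement [3,3,5] of [W]. *)
Definition emb (g : G335) : G := (1, g).
Definition rho0 : G := (sigma V0, 1).

Lemma embM : {morph emb : g h / g * h}.
Proof. by move=> g h; rewrite /emb mulE ract_1 mulg1. Qed.

Lemma projM : {morph (fun x : G => x.2) : x y / x * y}.
Proof. by []. Qed.

Lemma act_sigma F g : act (sigma F) g = sigma (vact F g).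
Proof. exact: (wact_sigma alpha335_central). Qed.

Lemma rho0_sq : rho0 * rho0 = 1.
Proof. by rewrite /rho0 mulE invg1 ract1 sigma_sq' mulg1. Qed.

Lemma conj_rho0 g : rho0 * emb g * rho0 = (sigma V0 * sigma (vact V0 g^-1), g) :> G.
Proof. by rewrite /rho0 /emb !mulE act_sigma !ract_1 !mul1g !mulg1. Qed.

Lemma rho335E : rho335 s ord0 = rho0.
Proof. by rewrite /rho335 /rho unlift_none. Qed.

Lemma rho335S j : rho335 s (up j) = emb (tau335 j).
Proof. by rewrite /rho335 /rho liftK. Qed.

Lemma rhotS j : rhot (up j) = emb (tau335 j).
Proof. by rewrite /halving_gen eq_sym (negbTE (neq_lift _ _)) rho335S. Qed.

Lemma rhot0 : rhot ord0 = rho0 * emb (tau335 ord0) * rho0.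
Proof. by rewrite /halving_gen eqxx rho335E rho335S. Qed.

Lemma emb1 : emb 1 = 1. Proof. by []. Qed.

Lemma conj_sq x : x * x = 1 -> (rho0 * x * rho0) * (rho0 * x * rho0) = 1.
Proof.
move=> xx; rewrite !mulgA -[_ * rho0 * rho0]mulgA rho0_sq mulg1.
by rewrite -[_ * x * x]mulgA xx mulg1 rho0_sq.
Qed.

Lemma rhot_sq i : rhot i * rhot i = 1.
Proof.
have Esq j : emb (tau335 j) * emb (tau335 j) = 1 by rewrite -embM tau335_sq.
case: (unliftP ord0 i) => [j|] ->; first by rewrite rhotS.
by rewrite rhot0 conj_sq.
Qed.

Lemma rhot_proj0 : (rhot ord0).2 = tau335 ord0.
Proof. by rewrite rhot0 conj_rho0. Qed.

Lemma rhot_projS j : (rhot (up j)).2 = tau335 j.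
Proof. by rewrite rhotS. Qed.

Lemma tau335_neq1 i : tau335 i <> 1.
Proof.
move=> e; have : dot (weight i) (tau335 i) = weight i by rewrite e dot1.
rewrite dot_tau; have : all (fun i : 'I_4 => fire (weight i) i != weight i) I4 by vm_compute.
by move/allP/(_ i (mem_I4 i))/eqP.
Qed.

Lemma rhot_neq1 i : rhot i <> 1.
Proof.
case: (unliftP ord0 i) => [j|] -> /(congr1 (@snd W G335)).
  by rewrite rhot_projS => /tau335_neq1.
by rewrite rhot_proj0 => /tau335_neq1.
Qed.

Lemma rho0_stab v : vstab tau335 v -> commute rho0 (emb v).
Proof.
move=> Vv; rewrite /commute /rho0 /emb !mulE act_sigma ract_1 mul1g !mulg1 mul1g.
congr (_, _); congr sigma; rewrite -{1}[V0]vact1; apply/vact_base_eq.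
by rewrite invgK mul1g.
Qed.

Lemma vstab_tau j : j != ord0 -> vstab tau335 (tau335 j).
Proof. by move=> j0; apply: mem_generated; exists j. Qed.

Lemma commuteJ (x y z : G) : commute x y -> commute x z -> commute x (y * z * y).
Proof. by move=> xy xz; apply: commuteM => //; apply: commuteM. Qed.

(** Nodes below and above a node [i >= 2] are not joined. *)
Lemma rhot_comm (a i b : 'I_5) : 2 <= i -> a < i -> i < b -> commute (rhot a) (rhot b).
Proof.
move=> i2; case: (unliftP ord0 b) => [b'|] -> ; last by rewrite ltn0.
have embc (j k : 'I_4) : j.+1 < k -> commute (emb (tau335 j)) (emb (tau335 k)).
  by move=> /tau_comm c; rewrite /commute -!embM c.
case: (unliftP ord0 a) => [a'|] -> ai ib; rewrite ?rhotS.
  by apply: embc; move: ai ib; rewrite /= /bump /=; lia.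
have b2 : 1 < b' by move: ib; rewrite /= /bump /=; lia.
have c1 : commute (emb (tau335 b')) rho0.
  apply/commute_sym/rho0_stab; apply: vstab_tau.
  by apply/eqP => e; rewrite e in b2.
have c2 : commute (emb (tau335 b')) (emb (tau335 ord0)) by apply/commute_sym/embc.
by rewrite rhot0; apply/commute_sym/commuteJ.
Qed.

Lemma emb_par (A : set 'I_4) g : parabolic tau335 A g ->
  par [set i | exists2 j, A j & i = up j] (emb g).
Proof.
move=> /(generated_morph embM); apply: generatedS => _ [_ [j Aj <-] <-].
by exists (up j); [exists j|rewrite rhotS].
Qed.

Lemma proj_par (A : set 'I_5) x : par A x ->
  parabolic tau335 [set j | A (up j) \/ (j = ord0 /\ A ord0)] x.2.
Proof.
move=> /(generated_morph projM); apply: generatedS => _ [_ [i Ai <-] <-].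
case: (unliftP ord0 i) Ai => [j|] -> Ai; first by exists j; [left|rewrite rhot_projS].
by exists ord0; [right|rewrite rhot_proj0].
Qed.

Lemma par0_emb x : M ord0 x -> x = emb x.2.
Proof.
suff sub : M ord0 `<=` range emb by move=> /sub[g _ <-].
apply: generated_min => [|_ [i + <-]].
  split=> [|_ _ [g _ <-] [h _ <-]]; first by exists 1.
  by exists (g * h^-1); rewrite // embM (morphV_group embM).
by case: (unliftP ord0 i) => [j|] -> //= _; exists (tau335 j); rewrite ?rhotS.
Qed.

Lemma par1_conj x : M (up ord0) x -> exists k, x = rho0 * emb k * rho0.
Proof.
have cM g h : rho0 * emb g * rho0 * (rho0 * emb h * rho0) = rho0 * emb (g * h) * rho0.
  by rewrite embM !mulgA -[_ * rho0 * rho0]mulgA rho0_sq mulg1.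
apply: (generated_min (K := [set x | exists k, x = rho0 * emb k * rho0])).
  split=> [|_ _ [g ->] [h ->]]; first by exists 1; rewrite emb1 mulg1 rho0_sq.
  exists (g * h^-1); rewrite -cM; congr (_ * _); apply: mulg1_eq.
  by rewrite cM mulgV emb1 mulg1 rho0_sq.
move=> _ [i + <-]; case: (unliftP ord0 i) => [j|] -> /=.
  move=> j0; exists (tau335 j); rewrite rhotS.
  have -> : rho0 * emb (tau335 j) = emb (tau335 j) * rho0.
    by apply: rho0_stab; apply: vstab_tau; apply: contra j0 => /eqP ->.
  by rewrite -mulgA rho0_sq mulg1.
by move=> _; exists (tau335 ord0); rewrite rhot0.
Qed.

(** The intersection of [3,3,5] with its conjugate by [rho0] is the stabilizer of
the base vertex, because [sigma] is injective. *)
Lemma conj_rho0_fixed k : rho0 * emb k * rho0 = emb k -> vstab tau335 k.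
Proof.
rewrite conj_rho0 => /(congr1 fst) /= /mulg1_eq; rewrite invol_inv ?sigma_sq' //.
move/sigma_inj => /(_ hs alpha335_free alpha335_invol); rewrite -{1}[V0]vact1.
by move/vact_base_eq; rewrite invgK mul1g.
Qed.

(** The diagram symmetry induced by conjugation with [rho0]. *)
Definition swap (i : 'I_5) : 'I_5 :=
  if i == ord0 then up ord0 else if i == up ord0 then ord0 else i.

Lemma swapK : involutive swap.
Proof.
move=> i; rewrite /swap; have [-> //|i0] := eqVneq i ord0.
by have [-> //|i1] := eqVneq i (up ord0); rewrite (negbTE i0) (negbTE i1).
Qed.

Definition conj0 (x : G) : G := rho0 * x * rho0.

Lemma conj0M : {morph conj0 : x y / x * y}.
Proof.
by move=> x y; rewrite /conj0 !mulgA -[_ * rho0 * rho0]mulgA rho0_sq mulg1.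
Qed.

Lemma conj0K : involutive conj0.
Proof. by move=> x; rewrite /conj0 !mulgA rho0_sq mul1g -mulgA rho0_sq mulg1. Qed.

Lemma conj0_rhot i : conj0 (rhot i) = rhot (swap i).
Proof.
rewrite /swap; have [->|i0] := eqVneq i ord0.
  by rewrite rhot0 -[_ * _ * _]/(conj0 _) conj0K rhotS.
have [->|i1] := eqVneq i (up ord0); first by rewrite rhotS rhot0.
case: (unliftP ord0 i) i0 i1 => [j|] -> // _ i1; rewrite rhotS /conj0.
rewrite rho0_stab ?mulgA -?mulgA ?rho0_sq ?mulg1 //.
by apply: vstab_tau; apply: contra i1 => /eqP ->.
Qed.

Lemma conj0_par A x : par A x -> par (swap @` A) (conj0 x).
Proof.
move=> /(generated_morph conj0M); apply: generatedS => _ [_ [i Ai <-] <-].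
by exists (swap i); [exists i|rewrite conj0_rhot].
Qed.

(** The maximal parabolic subgroup of the node 0 is the complement [3,3,5], so
this case reduces to the intersection property there; the node 1 contributes
the stabilizer of the base vertex. *)
Lemma meet_par0 (J : set 'I_5) x :
  J ord0 -> (forall j, J j -> M j x) -> par (~` J) x.
Proof.
move=> J0 Mx; have xE := par0_emb (Mx _ J0).
have : parabolic tau335 (~` [set j | J (up j)]) x.2.
  apply: meet_parabolic335 => j /Mx Mj; have [j0|j0] := eqVneq j ord0.
    move: Mj; rewrite j0 => /par1_conj[k xk].
    have kE : k = x.2 by rewrite xk conj_rho0.
    by apply: conj_rho0_fixed; rewrite -kE -xk kE -xE.
  apply: generatedS (proj_par Mj) => _ [k [nkj|[k0 _]] <-]; exists k => //=.
  by rewrite k0 eq_sym.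
move/emb_par; rewrite -xE; apply: generatedS => _ [_ [k nJk ->] <-].
by exists (up k).
Qed.

Lemma par_split (k : 'I_5) x : 2 <= k -> M k x ->
  exists u v, [/\ par [set i : 'I_5 | i < k] u, par [set i : 'I_5 | k < i] v,
    x = u * v & commute u v].
Proof.
move=> k2; apply: parabolic_split => [a b|i] /=; first exact: rhot_comm.
by rewrite -(inj_eq val_inj) neq_ltn => /orP.
Qed.

Lemma par_lt_max (k i : 'I_5) u : par [set j : 'I_5 | j < k] u -> k <= i -> M i u.
Proof.
move=> Pu ki; apply: generatedS Pu => _ [j jk <-]; exists j => //=.
by apply/eqP => ji; move: jk; rewrite /= ji ltnNge ki.
Qed.

Lemma par_gt_max (k i : 'I_5) u : par [set j : 'I_5 | k < j] u -> i <= k -> M i u.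
Proof.
move=> Pu ik; apply: generatedS Pu => _ [j kj <-]; exists j => //=.
by apply/eqP => ji; move: kj; rewrite /= ji ltnNge ik.
Qed.

(** When the node 0 is not in [J], either conjugation by [rho0] brings it there,
or the smallest node of [J] separates the diagram and the part above it lies in
[3,3,5]. *)
Lemma meet_halving (J : set 'I_5) x :
  H x -> (forall j, J j -> M j x) -> par (~` J) x.
Proof.
move=> Hx Mx; have [J0|nJ0] := pselect (J ord0); first exact: meet_par0.
have [J1|nJ1] := pselect (J (up ord0)).
  have : par (~` [set i | J (swap i)]) (conj0 x).
    apply: meet_par0 => //= j /Mx /conj0_par; apply: generatedS => _ [_ [i ij <-] <-].
    by exists (swap i) => //=; apply: contra ij => /eqP <-; rewrite swapK.
  move/conj0_par; rewrite conj0K; apply: generatedS => _ [_ [i nJi <-] <-].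
  by exists (swap i).
have [[j Jj]|nJ] := pselect (exists j, J j); last first.
  by apply: generatedS Hx => _ [i _ <-]; exists i => // Ji; apply: nJ; exists i.
pose P m := `[< exists2 j : 'I_5, J j & val j = m >].
have exP : exists m, P m by exists (val j); apply/asboolP; exists j.
case: (ex_minnP exP) => m /asboolP[k Jk km] minm.
have {}minm i : J i -> k <= i by move=> Ji; rewrite km; apply/minm/asboolP; exists i.
have k2 : 1 < k.
  case: (unliftP ord0 k) Jk => [[[|k'] ik]|] -> Jk //; case: nJ1.
  by congr J: Jk; apply: val_inj.
have [u [v [Pu Pv xE _]]] := par_split k2 (Mx k Jk).
have Pv' : par (~` [set i | i = ord0 \/ J i]) v.
  apply: meet_par0 => [|i [->|Ji]]; [by left|exact: (par_gt_max Pv)|].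
  have [->|ik] := eqVneq i k; first exact: (par_gt_max Pv).
  rewrite -[v](mulKg u) -xE; apply: generatedM; last exact: Mx.
  by apply: generatedV; apply: (par_lt_max Pu); apply: minm.
rewrite xE; apply: generatedM.
  apply: generatedS Pu => _ [i ik <-]; exists i => // /minm.
  by rewrite leqNgt ik.
by apply: generatedS Pv' => _ [i ni <-]; exists i => // Ji; apply: ni; right.
Qed.

(** The sigmas occurring in an element of [<rhot i | i < k>] belong to the
vertices of one simplex of the 600-cell. *)
Lemma par_lt_support (k : 'I_5) x : 2 <= k -> par [set i : 'I_5 | i < k] x ->
  let Q := parabolic tau335 [set j : 'I_4 | j.+1 < k] in
  Q x.2 /\ generated (sigma @` [set vact V0 q | q in Q]) x.1.
Proof.
move=> k2 Px /=; set Q := parabolic _ _; set S := generated _.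
have sQ : subgroup Q by exact: generated_subgroup.
have Sact u q : Q q -> S u -> S (act u q).
  move=> Qq; have actM := @ractM _ _ act q.
  move=> /(generated_morph actM); apply: generatedS => _ [_ [_ [p Qp <-] <-] <-].
  exists (vact V0 (p * q)); last by rewrite act_sigma vactM.
  by exists (p * q) => //; exact: subgroupM sQ Qp Qq.
have sS : subgroup S by exact: generated_subgroup.
suff sub : par [set i : 'I_5 | i < k] `<=` [set x | Q x.2 /\ S x.1] by exact: sub Px.
apply: generated_min.
  split=> [|[u g] [v h] [/= Qg Su] [/= Qh Sv]].
    by split; [exact: subgroup1 sQ|exact: subgroup1 sS].
  have QV : Q g^-1 by exact: subgroupV sQ Qg.
  split; first exact: subgroupM sQ Qg (subgroupV sQ Qh).
  change (S (u * act (act v^-1 h) g^-1)).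
  have Svh := Sact _ _ QV (Sact _ _ Qh (subgroupV sS Sv)).
  exact: subgroupM sS Su Svh.
move=> _ [i ik <-]; case: (unliftP ord0 i) ik => [j|] -> ik.
  rewrite rhotS; split; last exact: subgroup1 sS.
  by apply: mem_generated; exists j.
have Q0 : Q (tau335 ord0) by apply: mem_generated; exists ord0.
rewrite rhot0 conj_rho0; split=> //; apply: (subgroupM sS); apply: mem_generated.
  by exists V0 => //; exists 1; rewrite ?vact1 //; exact: subgroup1 sQ.
by eexists; last by []; exists (tau335 ord0)^-1 => //; exact: subgroupV sQ Q0.
Qed.

(** The step of the flag argument that is not of string type, where both nodes
[0] and [1] are present. The hypotheses say that the edge of the polytope from
the base vertex in some direction [F] lies in a face, and the vertex [F] must
then belong to the simplex of that face. *)
Lemma meet_cosets01 (k : 'I_5) h a b :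
  2 <= k -> par [set i : 'I_5 | i < k] h -> M (up ord0) a -> M ord0 b -> h = a * b ->
  exists c, [/\ M ord0 c, M k c & M (up ord0) (c * h^-1)].
Proof.
move=> k2 Ph Ma Mb hE; have [Qh Sh] := par_lt_support k2 Ph.
set Q := parabolic _ _ in Qh Sh.
have sQ : subgroup Q by exact: generated_subgroup.
have [p aE] := par1_conj Ma; have bE := par0_emb Mb; set p' := b.2 in bE.
have h2 : h.2 = p * p' by rewrite hE aE bE conj_rho0.
have h1 : h.1 = sigma V0 * sigma (vact V0 p^-1).
  by rewrite hE aE bE conj_rho0 /emb mulE ract_1 mulg1.
have [q Qq /esym] : [set vact V0 q | q in Q] (vact V0 p^-1).
  apply: (sigma_separated hs alpha335_free alpha335_invol).
  have S0 : generated (sigma @` [set vact V0 q | q in Q]) (sigma V0).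
    apply: mem_generated; exists V0 => //; exists 1; rewrite ?vact1 //.
    exact: subgroup1 sQ.
  rewrite h1 in Sh.
  by rewrite -[sigma (vact _ _)](mulKg (sigma V0)); apply: generatedM => //; apply: generatedV.
move/vact_base_eq; set v := p^-1 * q^-1 => Vv.
have p'E : p' = v * (q * h.2) by rewrite h2 /v !mulgA mulgVK mulVg mul1g.
have Qqh : Q (q * h.2) by exact: subgroupM sQ Qq Qh.
exists (emb (q * h.2)); split.
- by apply: generatedS (emb_par Qqh) => _ [_ [j _ ->] <-]; exists (up j).
- apply: generatedS (emb_par Qqh) => _ [_ [j jk ->] <-]; exists (up j) => //=.
  by apply/eqP => /(congr1 val); move: jk; rewrite /= /bump /=; lia.
have bE' : b = emb v * emb (q * h.2) by rewrite -embM -p'E.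
move: (q * h.2) bE' => g bE'; have -> : emb g * h^-1 = (emb v)^-1 * a^-1.
  by rewrite hE bE' !invgM !mulgA mulgV mul1g.
apply: generatedM; apply: generatedV => //; apply: generatedS (emb_par Vv) => _ [_ [j j0 ->] <-].
by exists (up j) => //=; apply: contra j0 => /eqP/lift_inj ->.
Qed.

Lemma cosets_meet (i j : 'I_5) (x y : G) :
  (exists2 z, rcoset (M i) x z & rcoset (M j) y z) ->
  exists2 z, M i (z * x^-1) & M j (z * y^-1).
Proof. by case=> z /rcosetP Mi /rcosetP Mj; exists z. Qed.

Lemma par_sub A x : par A x -> H x.
Proof. by apply: generatedS => _ [i _ <-]; exists i. Qed.

Lemma par_diff_trans i (x y z : G) : M i (x * y^-1) -> M i (y * z^-1) -> M i (x * z^-1).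
Proof.
move=> xy yz; have -> : x * z^-1 = (x * y^-1) * (y * z^-1) by rewrite mulgA mulgVK.
exact: generatedM.
Qed.

(** Pairwise meeting cosets are met one type at a time in increasing order.
Once a type [j >= 2] has been met, moving to the next type only uses the part
of [H_j] above [j], which leaves all previous cosets invariant. *)
Lemma meet_cosets_halving (J : set 'I_5) (c : 'I_5 -> G) :
  (forall j, J j -> H (c j)) ->
  (forall i j, J i -> J j -> exists2 z, rcoset (M i) (c i) z & rcoset (M j) (c j) z) ->
  exists2 g, H g & forall j, J j -> rcoset (M j) (c j) g.
Proof.
move=> Hc meet.
suff main m : m <= 5 -> exists2 g, H g & forall j : 'I_5, J j -> j < m -> M j (g * (c j)^-1).
  have [g Hg gP] := main 5 isT; exists g => // j Jj; apply/rcosetP; exact: gP.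
elim: m => [_|m IH m5]; first by exists 1; [exact: generated1|].
have [g Hg gP] := IH (ltnW m5); pose k := Ordinal m5.
have step g' : H g' -> (forall j : 'I_5, J j -> j < m -> M j (g' * (c j)^-1)) ->
    (J k -> M k (g' * (c k)^-1)) ->
    exists2 g, H g & forall j : 'I_5, J j -> j < m.+1 -> M j (g * (c j)^-1).
  move=> Hg' lo hi; exists g' => // j Jj; rewrite ltnS leq_eqVlt => /orP[/eqP jm|]; last exact: lo.
  by have jk : j = k by [apply: val_inj]; rewrite jk; apply: hi; rewrite -jk.
have [Jk|nJk] := pselect (J k); last exact: step Hg gP _.
have HM i z : J i -> M i (z * (c i)^-1) -> H z.
  move=> Ji /par_sub Hz; rewrite -[z](mulgVK (c i)); apply: generatedM => //; exact: Hc.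
pose P j := `[< exists2 i : 'I_5, J i & val i = j >] && (1 < j < m).
have [[j0 Pj0]|nP] := pselect (exists j, P j).
  have exP : exists j, P j by exists j0.
  have ubP j : P j -> j <= m by case/and3P=> _ _ /ltnW.
  case: (ex_maxnP exP ubP) => _ /and3P[/asboolP[j Jj <-] j1 jm] maxj.
  have [z Mjz Mkz] := cosets_meet (meet j k Jj Jk).
  have My : M j (z * g^-1).
    by have := generatedV (gP j Jj jm); rewrite invgF; apply: par_diff_trans Mjz.
  have [u [v [Pu Pv yE cuv]]] := par_split j1 My.
  apply: (step (v * g)).
  - by apply: generatedM => //; apply: par_sub Pv.
  - move=> i Ji im; rewrite -mulgA; apply: generatedM; last exact: gP.
    apply: (par_gt_max Pv); have [i2|i2] := leqP i 1; first exact: leq_trans i2 (ltnW j1).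
    by apply: maxj; rewrite /P i2 im !andbT; apply/asboolP; exists i.
  move=> _; have -> : v * g = u^-1 * z by rewrite -[z](mulgVK g) yE !mulgA mulVg mul1g.
  have Mku : M k u by apply: par_lt_max Pu _; apply: ltnW.
  by rewrite -mulgA; apply: generatedM => //; apply: generatedV.
have small i : J i -> i < m -> i <= 1.
  move=> Ji im; rewrite leqNgt; apply/negP => i2; apply: nP; exists (val i).
  by rewrite /P i2 im !andbT; apply/asboolP; exists i.
have le1 (i : 'I_5) : i <= 1 -> i = ord0 \/ i = up ord0.
  by case: i => [[|[|i]] lti] // _; [left|right]; apply: val_inj.
have [[J0 J1 k2]|n01] := pselect [/\ J ord0, J (up ord0) & 1 < m].
  have [z01 M0z01 M1z01] := cosets_meet (meet _ _ J0 J1).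
  have [z0 M0z0 Mkz0] := cosets_meet (meet _ _ J0 Jk).
  have [z1 M1z1 Mkz1] := cosets_meet (meet _ _ J1 Jk).
  have diff i x y z : M i (x * z^-1) -> M i (y * z^-1) -> M i (x * y^-1).
    by move=> xz yz; apply: par_diff_trans xz _; rewrite -invgF; apply: generatedV.
  have [u [v [Pu Pv hE cuv]]] := par_split (k := k) k2 (diff _ _ _ _ Mkz1 Mkz0).
  have M1v : M (up ord0) v by apply: par_gt_max Pv _; apply: ltnW.
  have uz0 : u * z0 = v^-1 * z1.
    by rewrite -[z1](mulgVK z0) hE cuv !mulgA mulVg mul1g.
  have uE : u = v^-1 * (z1 * z01^-1) * (z01 * z0^-1).
    by rewrite mulgA -[v^-1 * _ * z01]mulgA mulgVK -uz0 mulgK.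
  have [||w [M0w Mkw M1w]] := meet_cosets01 (k := k) k2 Pu _ _ uE.
  - by apply: generatedM (diff _ _ _ _ M1z1 M1z01); apply: generatedV.
  - exact: diff M0z01 M0z0.
  apply: (step (w * z0)) => [|i Ji im|_].
  - by apply: generatedM; [exact: par_sub M0w|exact: HM M0z0].
  - have [->|->] := le1 i (small i Ji im); first by rewrite -mulgA; exact: generatedM M0w M0z0.
    have -> : w * z0 * (c (up ord0))^-1 = (w * u^-1) * (v^-1 * (z1 * (c (up ord0))^-1)).
      by rewrite [v^-1 * _]mulgA -uz0 !mulgA mulgVK.
    exact: generatedM M1w (generatedM (generatedV M1v) M1z1).
  - by rewrite -mulgA; exact: generatedM Mkw Mkz0.
have [[i Ji im]|ni] := pselect (exists2 i : 'I_5, J i & i < m); last first.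
  apply: (step (c k)) => [|i Ji im|_]; first exact: Hc; last by rewrite mulgV; exact: generated1.
  by case: ni; exists i.
have [z Miz Mkz] := cosets_meet (meet i k Ji Jk).
apply: (step z) => // [|i' Ji' im']; first exact: HM Miz.
suff -> : i' = i by [].
case: (le1 i (small i Ji im)) (le1 i' (small i' Ji' im')) => e [] e';
  rewrite e e' // in Ji im Ji' im' *.
  by case: n01.
by case: n01.
Qed.

Theorem halving_regular_hypertope : regular_hypertope (halving_system (rho335 s)).
Proof.
exact: coset_regular_hypertope rhot_sq rhot_neq1 meet_halving meet_cosets_halving.
Qed.

Theorem halving_automorphism_group :
  automorphism_group_is_H (halving_group (rho335 s)) (halving_parabolic (rho335 s)).
Proof.
exact: coset_automorphism_group rhot_sq rhot_neq1 meet_halving meet_cosets_halving.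
Qed.

(** * The order of the halving group *)

Lemma two_W_generated u : generated (range sigma) u.
Proof.
rewrite (weval_repr u) /weval; elim: (repr u) => [|[F b] w IH].
  by rewrite big_nil; apply: generated1.
have gF : generated (range sigma) (sigma F) by apply: mem_generated; exists F.
rewrite big_cons; apply: generatedM IH.
by case: b => //=; apply: generatedV.
Qed.

Lemma two_group_elements : exists E : seq G,
  [/\ uniq E, size E = ((2 * s) ^ 60 * (72 * 100 * 2))%N & forall y, y \in E].
Proof.
have [r [ur s60 cover anti]] := half_vertices.
have [EW [uW sW WP]] := two_W_elements hs alpha335_free alpha335_invol ur anti.
have [EK [uK sK KP]] := elements335.
exists [seq ((u, g) : G) | u <- EW, g <- EK]; split.
- by apply: allpairs_uniq => // -[u g] [v h].
- by rewrite size_allpairs sW sK s60.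
move=> [u g]; apply/allpairsP; exists (u, g); split=> //=; apply/WP.
have -> : pairs alpha335 r = setT by apply/seteqP; split=> // F _; apply: cover.
exact: two_W_generated.
Qed.

Lemma parity_act (u : W) g : parity (act u g) = parity u.
Proof.
have pM := @parityM G335 3 tau335 alpha335 s.
apply: (@pgroup_ext _ _ _ (fun u => parity (act u g)) (@parity _ _ _ _ s)) => //.
  move=> v w; change (parity (act (v * w) g) = parity (act v g) * parity (act w g)).
  by rewrite ractM pM.
by move=> F; rewrite -[pgen _ F]/(sigma F) act_sigma !parity_sigma.
Qed.

Lemma H_even y : H y -> parity y.1 = 1.
Proof.
have pM := @parityM G335 3 tau335 alpha335 s.
pose q (t : G) := parity t.1.
have qM : {morph q : t1 t2 / t1 * t2}.
  by move=> [u g] [v h]; rewrite mulE /q /= pM parity_act.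
suff sub : H `<=` [set t | q t = 1] by exact: sub.
apply: generated_min => [|_ [i _ <-]].
  split=> [|t1 t2 /= p1 p2]; first exact: morph1_group qM.
  by rewrite qM (morphV_group qM) p1 p2 mulgV.
rewrite /= /q; case: (unliftP ord0 i) => [j|] ->; first by rewrite rhotS; exact: morph1_group pM.
by rewrite rhot0 conj_rho0 /= pM !parity_sigma.
Qed.

Lemma H_conj0 y : H y -> H (conj0 y).
Proof.
move=> /(generated_morph conj0M); apply: generatedS => _ [_ [i _ <-] <-].
by exists (swap i); rewrite ?conj0_rhot.
Qed.

Lemma H_emb g : H (emb g).
Proof.
have := parab_all g; move/(generated_morph embM); apply: generatedS.
by move=> _ [_ [j _ <-] <-]; exists (up j); rewrite ?rhotS.
Qed.

(** [rho0] normalizes [H] and generates the whole group together with it. *)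
Lemma H_index2 y : H y \/ H (y * rho0).
Proof.
have rr : rho0 * rho0 = 1 by exact: rho0_sq.
have E g y' : H y' \/ H (y' * rho0) -> H (y' * emb g) \/ H (y' * emb g * rho0).
  case=> Hy; first by left; apply: generatedM Hy (H_emb g).
  right; have -> : y' * emb g * rho0 = (y' * rho0) * conj0 (emb g).
    by rewrite /conj0 !mulgA -[_ * rho0 * rho0]mulgA rr mulg1.
  exact: generatedM Hy (H_conj0 (H_emb g)).
have Rr y' : H y' \/ H (y' * rho0) -> H (y' * rho0) \/ H (y' * rho0 * rho0).
  by rewrite -mulgA rr mulg1; case; [right|left].
case: y => u g; have -> : ((u, g) : G) = ((u, 1) : G) * emb g.
  by rewrite /emb mulE ract_1 mulg1 mul1g.
apply/E; elim/generated_ind: (two_W_generated u) => {u} [_ [F _ <-]||u _ _ IH [F _ <-]].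
- exact: sigma_sq.
- by left; apply: generated1.
have [f ->] := vertexP F.
have -> : ((u * sigma (vact V0 f), 1) : G) = ((u, 1) : G) * emb f^-1 * rho0 * emb f.
  rewrite /emb /rho0 !mulE !ract_1 !mulg1 !mul1g invgK mulVg.
  by rewrite act_sigma.
by apply: (E); apply: (Rr); apply: (E).
Qed.

(** Right multiplication by [rho0] exchanges the halving group with its
complement. *)
Lemma halving_order : H #= `I_(72 * 100 * (2 * s) ^ 60)%N.
Proof.
have [E [uE sE EP]] := two_group_elements.
have rr : rho0 * rho0 = 1 by exact: rho0_sq.
pose h := fun y : G => `[< H y >].
have hr y : h (y * rho0) = ~~ h y.
  apply/asboolP/idP.
    move=> Hy; apply/negP => /asboolP Hy'.
    have Hr : H rho0 by rewrite -[rho0](mulKg y); apply: generatedM => //; apply: generatedV.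
    by have := H_even Hr; rewrite /= parity_sigma.
  move=> nHy; case: (H_index2 y) => // Hy; case/negP: nHy; exact/asboolP.
have half : size (filter (predC h) E) = size (filter h E).
  rewrite -(size_map (fun y => y * rho0) (filter h E)); apply: perm_size.
  apply: uniq_perm; [exact: filter_uniq|by rewrite map_inj_uniq ?filter_uniq //; apply: mulIg|].
  move=> y; rewrite mem_filter EP andbT; apply/idP/mapP.
    move=> nhy; exists (y * rho0); last by rewrite -mulgA rr mulg1.
    by rewrite mem_filter EP hr andbT.
  by case=> t; rewrite mem_filter => /andP[ht _] ->; rewrite /= hr negbK.
have sz : size (filter h E) = (72 * 100 * (2 * s) ^ 60)%N.
  have := count_predC h E; rewrite -!size_filter half sE; lia.
rewrite -sz; apply: card_eq_uniq_seq; first exact: filter_uniq.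
move=> y; rewrite mem_filter EP andbT; split=> [/asboolP|Hy]; [exact|exact/asboolP].
Qed.

(** * The presentation *)

Local Notation R := (cox_rels halving_cox335 `|` extra_rels s).
Local Notation P := (pgroup R).
Local Notation x := (pgen R).

Lemma halving_cox_up (i j : 'I_4) : halving_cox335 (up i) (up j) = string_cox [:: 3; 3; 5] i j.
Proof. by case_I4 i; case_I4 j. Qed.

Lemma halving_cox_swap i j : halving_cox335 (swap i) (swap j) = halving_cox335 i j.
Proof.
case: (unliftP ord0 i) => [i'|] ->; [case_I4 i'|];
  (case: (unliftP ord0 j) => [j'|] ->; [case_I4 j'|]); by [].
Qed.

Lemma halving_coxC i j : halving_cox335 i j = halving_cox335 j i.
Proof. by rewrite /halving_cox335 eq_sym minnC maxnC. Qed.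

Let B := weval x beta.
Let Bt := weval x betat.

Lemma x_rel i j : (x i * x j) ^+ halving_cox335 i j = 1.
Proof. by rewrite -weval_cox; apply: weval_rel; left; exists i, j. Qed.

Lemma x_sq i : x i * x i = 1.
Proof. by have := x_rel i i; rewrite /halving_cox335 eqxx. Qed.

Lemma extra_rel e : e \in [:: 4; 6; 7; 9; 10; 12]%N -> (Bt^-1 ^+ e * B ^+ e) ^+ 2 = 1.
Proof.
move=> ee; rewrite /B /Bt -weval_winv -!weval_wexp -weval_cat -weval_wexp.
by apply: weval_rel; right; left; exists e.
Qed.

Lemma extra_rel_s : (Bt ^+ 15 * B ^+ 15) ^+ s = 1.
Proof.
by rewrite /B /Bt -!weval_wexp -weval_cat -weval_wexp; apply: weval_rel; right; right.
Qed.

Lemma weval_swap_beta (K : groupType) (y : 'I_5 -> K) :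
  weval (y \o swap) beta = weval y betat /\ weval (y \o swap) betat = weval y beta.
Proof.
rewrite /weval !big_cons !big_nil /=; split; congr (_ * (_ * (_ * (_ * _))));
  congr y; exact: val_inj.
Qed.

(** The exchange of the generators 0 and 1 replaces the base of each squared
extra relator by its inverse, and rotates the base of the remaining one. *)
Lemma theta_rel r : R r -> weval (x \o swap) r = 1.
Proof.
have [sb sbt] := weval_swap_beta x.
case=> [[i [j ->]]|[[e ee ->]|->]].
- by rewrite weval_cox /= -halving_cox_swap x_rel.
- rewrite weval_wexp weval_cat !weval_wexp weval_winv sb sbt -/B -/Bt.
  have := expgV_eq1 (extra_rel ee); rewrite invgM -!expVgn invgK.
  by rewrite !expVgn.
- by rewrite weval_wexp weval_cat !weval_wexp sb sbt; apply: expg_rot extra_rel_s.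
Qed.

Definition theta : P -> P := pg_lift (x \o swap).

Lemma thetaM : {morph theta : u v / u * v}. Proof. exact: pg_liftM theta_rel. Qed.

Lemma theta_gen i : theta (x i) = x (swap i). Proof. exact: pg_lift_gen theta_rel. Qed.

Lemma thetaK : involutive theta.
Proof.
apply: (@pgroup_ext _ _ _ (theta \o theta) id) => // [u v|i] /=; first by rewrite !thetaM.
by rewrite !theta_gen swapK.
Qed.

Definition flip (u : P) (e : sign) : P := if e : bool then theta u else u.

Lemma flipM e : {morph flip^~ e : u v / u * v}.
Proof. by case: e => u v //=; apply: thetaM. Qed.

Lemma flip1 u : flip u 1 = u. Proof. by []. Qed.

Lemma flipJ u e f : flip (flip u e) f = flip u (e * f).
Proof. by case: e; case: f => //=; apply: thetaK. Qed.

Definition Pext : groupType := sdprod (RAction flipM flip1 flipJ).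

Definition inP (u : P) : Pext := (u, 1).
Definition zeta : Pext := (1, true : sign).

Lemma inPM : {morph inP : u v / u * v}.
Proof. by []. Qed.

Lemma inP_inj : injective inP. Proof. by move=> u v []. Qed.

Lemma mul_ext (u v : P) (e f : sign) :
  ((u, e) : Pext) * ((v, f) : Pext) = (u * flip v e^-1, e * f) :> Pext.
Proof. by []. Qed.

Lemma theta1 : theta 1 = 1. Proof. exact: morph1_group thetaM. Qed.

Lemma zeta_sq : zeta * zeta = 1.
Proof. by rewrite /zeta mul_ext /= theta1 mulg1. Qed.

Lemma zetaJ u : zeta * inP u * zeta = inP (theta u).
Proof. by rewrite /zeta /inP !mul_ext /= theta1 !mulg1 mul1g. Qed.

Local Notation X i := (inP (x i)).

Lemma inP1 : inP 1 = 1. Proof. by []. Qed.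

Lemma inPX u n : inP u ^+ n = inP (u ^+ n).
Proof. by elim: n => [//|n IH]; rewrite !expgS IH inPM. Qed.

Lemma zeta_comm i : swap i = i -> commute zeta (X i).
Proof.
move=> si; have := zetaJ (x i); rewrite theta_gen si => e.
by rewrite /commute -[in RHS]e -!mulgA zeta_sq mulg1.
Qed.

Lemma swap_up (j : 'I_4) : j != ord0 -> swap (up j) = up j.
Proof.
move=> j0; rewrite /swap eq_sym (negbTE (neq_lift _ _)); case: eqP => // /lift_inj e.
by rewrite e eqxx in j0.
Qed.

Lemma phiK_rel r : cox_rels (@string_cox 4 [:: 3; 3; 5]) r ->
  weval (fun j : 'I_4 => X (up j)) r = 1.
Proof.
case=> i [j ->]; rewrite weval_cox -inPM -halving_cox_up.
by rewrite inPX x_rel.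
Qed.

Definition phiK : G335 -> Pext := pg_lift (fun j : 'I_4 => X (up j)).

Lemma phiKM : {morph phiK : g h / g * h}. Proof. exact: pg_liftM phiK_rel. Qed.

Lemma phiK_tau j : phiK (tau335 j) = X (up j). Proof. exact: pg_lift_gen phiK_rel. Qed.

Lemma phiK_stab v : vstab tau335 v -> zeta ^ phiK v = zeta.
Proof.
move=> Vv; suff c : commute zeta (phiK v) by rewrite conjgE c mulgA mulVg mul1g.
suff sub : vstab tau335 `<=` [set v | commute zeta (phiK v)] by exact: sub Vv.
apply: generated_min => [|_ [j j0 <-]] /=.
  split=> [|g h /= cg ch]; first by rewrite /= (morph1_group phiKM); apply: commute1.
  by rewrite phiKM (morphV_group phiKM); apply: commuteM => //; apply: commuteV.
by rewrite phiK_tau; apply/zeta_comm/swap_up.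
Qed.

(** The conjugate of [zeta] does not depend on the group element chosen to reach
the vertex, because the stabilizer of the base vertex commutes with [zeta]
([phiK_stab]). *)
Definition phiV (F : vertex tau335) : Pext := zeta ^ phiK (sval (cid (vertexP F))).

Lemma phiV_base g : phiV (vact V0 g) = zeta ^ phiK g.
Proof.
rewrite /phiV; case: cid => h /= e; have /vact_base_eq Vgh := e.
by rewrite -[g](mulgVK h) phiKM conjgM (phiK_stab Vgh).
Qed.

Lemma phiV_act F g : phiV (vact F g) = phiV F ^ phiK g.
Proof. by have [h ->] := vertexP F; rewrite vactM !phiV_base phiKM conjgM. Qed.

Lemma phiV_sq F : phiV F * phiV F = 1.
Proof. by have [h ->] := vertexP F; rewrite phiV_base -conjMg zeta_sq conj1g. Qed.

Lemma phiK_cox : phiK cox335 = inP B.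
Proof.
rewrite /cox335 /ev /B /weval !big_cons !big_nil !phiKM !phiK_tau (morph1_group phiKM).
by rewrite /= -inP1 -!inPM; congr (inP (x _ * (x _ * (x _ * (x _ * _))))); apply: val_inj.
Qed.

Lemma theta_B : theta B = Bt.
Proof.
rewrite /B (morph_weval _ _ thetaM); have [e _] := weval_swap_beta x; rewrite /Bt -e.
by congr (weval _ _); apply/funext => i; apply: theta_gen.
Qed.

Lemma thetaX u n : theta (u ^+ n) = theta u ^+ n.
Proof. by elim: n => [|n IH]; [exact: theta1|rewrite !expgS thetaM IH]. Qed.

Lemma phiK_coxX e : phiK (cox335 ^+ e) = inP (B ^+ e).
Proof.
elim: e => [|e IH]; first exact: morph1_group phiKM.
by rewrite !expgS phiKM IH phiK_cox inPM.
Qed.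

(** The link between the extra relators and the relations of [W]: the right-hand
side is the word raised to a power in a relator, and the left-hand side the
product of two conjugates of [zeta], that is, of the images of two [sigma]s. *)
Lemma zeta_conj_cox e : zeta * zeta ^ phiK (cox335 ^+ e) = inP (Bt^-1 ^+ e * B ^+ e).
Proof.
rewrite phiK_coxX conjgE inPM !mulgA; congr (_ * _).
rewrite -(morphV_group inPM) zetaJ (morphV_group thetaM) thetaX theta_B.
by rewrite expVgn.
Qed.

(** For the vertices adjacent to the base vertex the relation is a consequence
of the commutation of the generators 0 and 1. *)
Lemma Bt_B_sq : (Bt^-1 * B) ^+ 2 = 1.
Proof.
pose D := weval x (behead beta).
have BE : B = x (up ord0) * D.
  by rewrite /B /D [LHS]/weval big_cons; congr (x _ * _); apply: val_inj.
have BtE : Bt = x ord0 * D.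
  by rewrite /Bt /D [LHS]/weval big_cons; congr (x _ * _); apply: val_inj.
have -> : Bt^-1 * B = (x ord0 * x (up ord0)) ^ D.
  by rewrite BE BtE invgM (invol_inv (x_sq ord0)) conjgE !mulgA.
by rewrite -conjXg (x_rel ord0 (up ord0)) conj1g.
Qed.

Lemma zeta_conj_middle e : e \in [:: 1; 4; 6; 7; 9; 10; 12]%N ->
  (zeta * zeta ^ phiK (cox335 ^+ e)) ^+ 2 = 1.
Proof.
rewrite inE zeta_conj_cox inPX => /orP[/eqP ->|/extra_rel -> //].
by rewrite !expg1 Bt_B_sq.
Qed.

Lemma B_pow30 : B ^+ 30 = 1.
Proof.
apply: inP_inj; rewrite -phiK_coxX (expgnDr _ 15 15) -alpha335E alpha335_sq.
exact: morph1_group phiKM.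
Qed.

(** The relator has positive exponents where the commutator has a negative one;
the difference is absorbed by [beta ^ 30 = 1]. *)
Lemma zeta_conj_alpha : (zeta * zeta ^ phiK alpha335) ^+ s = 1.
Proof.
rewrite alpha335E zeta_conj_cox inPX.
have -> : Bt^-1 ^+ 15 = Bt ^+ 15.
  rewrite expVgn; apply: mulg1_eq; rewrite -expgnDr -theta_B -thetaX.
  by rewrite (_ : (15 + 15)%N = 30%N) // B_pow30 theta1.
by rewrite extra_rel_s.
Qed.

(** By transitivity and commutation with the stabilizer of the base vertex, only
the pairs formed by the base vertex and its images under [cox_powers] matter. *)
Lemma phiV_rel r : cox_rels (@vcox G335 3 tau335 alpha335 s) r -> weval phiV r = 1.
Proof.
apply: vcox_lift => [F|F|F F' nF nFa]; first exact: phiV_sq.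
  have [g ->] := vertexP F.
  have -> : vact (vact V0 g) alpha335 = vact V0 (alpha335 * g) by rewrite vactM alpha335_central.
  by rewrite !phiV_base phiKM conjgM -conjMg -conjXg zeta_conj_alpha conj1g.
have [g FE] := vertexP F; have [g' F'E] := vertexP F'; pose h := g' * g^-1.
have {}F'E : F' = vact (vact V0 h) g by rewrite F'E vactM mulgVK.
have [e [v [ee Vv hE]]] := suborbits h.
have fixv : vact V0 v = V0 by rewrite -[RHS]vact1; apply/vact_base_eq; rewrite invg1 mulg1.
have em : e \in [:: 1; 4; 6; 7; 9; 10; 12]%N.
  have e0 : e != 0%N.
    apply/eqP => e0; apply: nF.
    by rewrite F'E FE hE e0 expg0 mul1g fixv.
  have e15 : e != 15%N.
    apply/eqP => e15; apply: nFa.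
    by rewrite F'E FE hE e15 -alpha335E alpha335_central -vactM fixv !vactM alpha335_central.
  by move: ee; rewrite !inE (negbTE e0) (negbTE e15) orbF.
rewrite F'E FE phiV_base (phiV_act _ g) hE phiV_base phiKM conjgM -{1}(phiK_stab Vv).
by rewrite -conjMg -conjMg -!conjXg zeta_conj_middle // !conj1g.
Qed.

Definition phiW : W -> Pext := pg_lift phiV.

Lemma phiWM : {morph phiW : u v / u * v}. Proof. exact: pg_liftM phiV_rel. Qed.

Lemma phiW_sigma F : phiW (sigma F) = phiV F. Proof. exact: pg_lift_gen phiV_rel. Qed.

Lemma phiW_act u g : phiW (act u g) = phiW u ^ phiK g.
Proof.
apply: (@pgroup_ext _ _ _ (fun u => phiW (act u g)) (fun u => phiW u ^ phiK g)).
- move=> v w; change (phiW (act (v * w) g) = phiW (act v g) * phiW (act w g)).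
  by rewrite ractM phiWM.
- by move=> v w /=; rewrite phiWM conjMg.
- move=> F; rewrite -[pgen _ F]/(sigma F) act_sigma !phiW_sigma; exact: phiV_act.
Qed.

Definition phi (y : G) : Pext := phiW y.1 * phiK y.2.

Lemma phiM : {morph phi : y t / y * t}.
Proof.
move=> [u g] [v h]; rewrite mulE /phi /= phiWM phiKM phiW_act (morphV_group phiKM).
by rewrite conjgE invgK !mulgA mulgVK.
Qed.

Lemma phi_rhot i : phi (rhot i) = X i.
Proof.
have phi_emb g : phi (emb g) = phiK g by rewrite /phi /= (morph1_group phiWM) mul1g.
case: (unliftP ord0 i) => [j|] ->; first by rewrite rhotS phi_emb phiK_tau.
have phi_rho0 : phi rho0 = zeta.
  rewrite /phi /= phiW_sigma (morph1_group phiKM) mulg1 -[V0]vact1 phiV_base.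
  by rewrite (morph1_group phiKM) conjg1.
rewrite rhot0 !phiM phi_emb phi_rho0 phiK_tau zetaJ theta_gen.
by congr (inP (x _)).
Qed.

(** [phi] is a left inverse of the natural map from [P] to the halving group. *)
Lemma rhot_relators w : weval rhot w = 1 -> wequiv R w [::].
Proof.
move=> /(congr1 phi); rewrite (morph_weval _ _ phiM) (morph1_group phiM).
have -> : phi \o rhot = inP \o x by apply/funext => i /=; rewrite phi_rhot.
rewrite -(morph_weval _ _ inPM) -inP1 => /inP_inj; rewrite weval_pgen.
by move/pg_classP.
Qed.

Lemma base_tau0_neq_alpha : vact V0 (tau335 ord0) <> vact V0 alpha335.
Proof.
have n0 : fire (weight 0) ord0 != antipode (weight 0) by vm_compute.
have a0 : antipode (weight 0) = dot (weight 0) alpha335.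
  by rewrite -[alpha335]mul1g dot_antipode dot1.
by move/vact335_eq => e0; move: n0; rewrite a0 -dot_tau e0 eqxx.
Qed.

Lemma conj0_emb_commutator g : conj0 (emb g^-1) * emb g = (sigma V0 * sigma (vact V0 g), 1) :> G.
Proof.
by rewrite /conj0 conj_rho0 invgK /emb mulE ract_1 mulg1 mulVg.
Qed.

Lemma pair_expg (u : W) e : ((u, 1) : G) ^+ e = (u ^+ e, 1) :> G.
Proof.
by elim: e => [//|e IH]; rewrite !expgS IH mulE invg1 ract1 mulg1.
Qed.

Lemma embX g e : emb g ^+ e = emb (g ^+ e).
Proof. by elim: e => [//|e IH]; rewrite !expgS IH embM. Qed.

Lemma conj0X y e : conj0 (y ^+ e) = conj0 y ^+ e :> G.
Proof.
by elim: e => [|e IH]; [exact: morph1_group conj0M|rewrite !expgS conj0M IH].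
Qed.

Lemma rhot_cox i j : (rhot i * rhot j) ^+ halving_cox335 i j = 1.
Proof.
have upup a b : (rhot (up a) * rhot (up b)) ^+ halving_cox335 (up a) (up b) = 1.
  by rewrite !rhotS -embM embX halving_cox_up tau335_rel.
have zero b : (rhot ord0 * rhot (up b)) ^+ halving_cox335 ord0 (up b) = 1.
  have [->|b0] := eqVneq b ord0.
    rewrite rhot0 rhotS -/(conj0 _) -{1}(invol_inv (tau335_sq ord0)) conj0_emb_commutator pair_expg.
    congr (_, _); apply: comm_invol; try exact: sigma_sq.
    exact/sigma_comm/base_tau0_neq_alpha.
  have := upup ord0 b; move/(congr1 conj0); rewrite conj0X conj0M !conj0_rhot.
  rewrite -halving_cox_swap (swap_up b0) => ->; exact: morph1_group conj0M.
case: (unliftP ord0 i) => [a|] ->; case: (unliftP ord0 j) => [b|] ->.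
- exact: upup.
- by rewrite halving_coxC; apply/expg_rot/zero.
- exact: zero.
- by rewrite /halving_cox335 eqxx; apply: rhot_sq.
Qed.

Lemma rhot_beta : weval rhot beta = emb cox335.
Proof.
rewrite /weval /cox335 /ev !big_cons !big_nil !embM /=.
have rE k (j : 'I_4) : k = up j -> rhot k = emb (tau335 j) by move=> ->; apply: rhotS.
by congr (_ * (_ * (_ * (_ * _)))); apply: rE; apply: val_inj.
Qed.

Lemma rhot_betat : weval rhot betat = conj0 (emb cox335).
Proof.
rewrite -rhot_beta (morph_weval _ _ conj0M) /weval !big_cons !big_nil /=.
by congr (_ * (_ * (_ * (_ * _)))); rewrite conj0_rhot; congr rhot; apply: val_inj.
Qed.

Lemma rhot_rel r : R r -> weval rhot r = 1.
Proof.
have word e : weval rhot (wexp (winv betat) e ++ wexp beta e) =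
    (sigma V0 * sigma (vact V0 (cox335 ^+ e)), 1) :> G.
  rewrite weval_cat !weval_wexp weval_winv rhot_beta rhot_betat -conj0_emb_commutator.
  by rewrite (morphV_group embM) (morphV_group conj0M) -embX conj0X expVgn.
case=> [[i [j ->]]|[[e ee ->]|->]].
- by rewrite weval_cox rhot_cox.
- rewrite weval_wexp word pair_expg; congr (_, _); apply: comm_invol; try exact: sigma_sq.
  exact/sigma_comm/cox_power_neq_alpha.
rewrite weval_wexp weval_cat !weval_wexp rhot_beta rhot_betat -conj0X embX -alpha335E.
rewrite -{1}(mulg1_eq alpha335_sq) conj0_emb_commutator pair_expg; congr (_, _).
have := @sigma_rel G335 3 tau335 alpha335 s V0 (vact V0 alpha335).
by rewrite /vcox eqxx; case: eqP => // /alpha335_free.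
Qed.

Theorem halving_presented : presented_by (halving_group (rho335 s)) rhot R.
Proof.
split=> // w; split; first exact: rhot_relators.
by move/(weval_wequiv rhot_rel) => ->; rewrite /weval big_nil.
Qed.

End Halving335.

Local Close Scope group_scope.

Theorem proposition4p8 (s : nat) (hs : (2 <= s)%N) :
  let rhot := halving_gen (rho335 s) in
  let H := halving_group (rho335 s) in
  let Gam := halving_system (rho335 s) in
  [/\ regular_hypertope Gam,
      automorphism_group_is_H H (halving_parabolic (rho335 s)),
      H #= `I_(72 * 100 * (2 * s) ^ 60) &
      presented_by H rhot (cox_rels halving_cox335 `|` extra_rels s)].
Proof.
move=> rhot H Gam; split.
- exact: halving_regular_hypertope hs.
- exact: halving_automorphism_group hs.
- exact: halving_order hs.
- exact: halving_presented.
Qed.
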